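(* Fix parameters $t \in [0,1)$ and $\theta > 0$. Let $N$ be a Poisson random variable with mean $\theta^2$, and apply the patience sorting algorithm with error probability $t$ to a uniformly randomly shuffled deck of $N$ cards. The number of piles created by this algorithm has the same law as the height function $\mathfrak{H}(1,1)$ of the $t$-PNG model with intensity $\theta^2$ on $[0,1]\times[0,1]$ (without boundary conditions).
   Context: Patience sorting with error probability $t$: start with a deck of $N$ cards labeled $\{1,\ldots,N\}$ in some order; cards are drawn one at a time from the top and sorted into piles. When card $i$ is drawn, consider all current piles $\mathcal{P}_1,\ldots,\mathcal{P}_g$ whose top cards are greater than $i$, with top cards $c_1<c_2<\cdots<c_g$ respectively. Set $k=1$. (a) If $k\le g$: with probability $1-t$ (independently of everything else) place card $i$ on top of pile $\mathcal{P}_k$; with probability $t$, ''miss'' this pile by replacing $k$ by $k+1$ and repeating. (b) If $k>g$, create a new pile consisting of card $i$. Repeat until all cards are sorted. The $t$-PNG model with intensity $\theta^2$ on $[0,1]\times[0,1]$: sample a Poisson point process of intensity $\theta^2$ on the square. From each point draw two rays, one directed north and one directed east. Whenever a vertical and a horizontal ray emanating from different points meet, then, independently of everything else, with probability $1-t$ they annihilate each other (both stop at the meeting point) and with probability $t$ they pass through each other. The height function $\mathfrak{H}(x,y)$ is the number of horizontal rays intersecting the vertical segment $\{x\}\times[0,y]$. *)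

(* Defs.v *)
From HB Require Import structures.
From mathcomp Require Import all_boot all_order all_algebra finmap.
From mathcomp Require Import all_classical all_reals all_analysis.
From mathcomp Require Import zify.

Set Implicit Arguments.
Unset Strict Implicit.
Unset Printing Implicit Defensive.

Import Order.TTheory GRing.Theory Num.Theory.
Import numFieldNormedType.Exports.

Local Open Scope classical_set_scope.
Local Open Scope ring_scope.

Definition mutually_independent (R : realType) (d : measure_display)
    (T : measurableType d) (P : probability T R)
    (I : choiceType) (F : I -> set (set T)) : Prop :=
  forall (J : {fset I}) (E : I -> set T),
    (forall i, i \in J -> F i (E i)) ->
    P (\bigcap_(i in [set` J]) E i) = (\prod_(i <- J) P (E i))%E.

(* A family of independent Bernoulli(p) variables which is moreover independent
   of the sigma-algebra [G], the index [None] standing for [G]. *)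
Definition bernoulli_coins (R : realType) (p : R) (d : measure_display)
    (T : measurableType d) (P : probability T R) (G : set (set T))
    (I : choiceType) (c : I -> {RV P >-> bool}) : Prop :=
  (forall i, distribution P (c i) =1 bernoulli_prob p) /\
  mutually_independent P
    (fun o : option I => if o is Some i then g_sigma_algebra_preimage (c i)
                         else G).

Definition same_law (R : realType)
    (d1 : measure_display) (T1 : measurableType d1) (P1 : probability T1 R)
    (d2 : measure_display) (T2 : measurableType d2) (P2 : probability T2 R)
    (d : measure_display) (V : measurableType d)
    (X1 : T1 -> V) (X2 : T2 -> V) : Prop :=
  [/\ measurable_fun [set: T1] X1, measurable_fun [set: T2] X2 &
      forall B, measurable B -> P1 (X1 @^-1` B) = P2 (X2 @^-1` B)].

Section patience_sorting.
(* [miss i k]: card [i] misses the [k]-th pile offered to it ([k] >= 1). *)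
Variable miss : nat -> nat -> bool.

(* A pile is listed from its top card down; piles are never empty. *)
Definition top (p : seq nat) : nat := head 0%N p.

(* The piles on which card [i] may be placed, by increasing top card. *)
Definition eligible (i : nat) (piles : seq (seq nat)) : seq (seq nat) :=
  sort (fun p q => (top p <= top q)%N) [seq p <- piles | (i < top p)%N].

Fixpoint choose_pile (i k : nat) (ps : seq (seq nat)) : option (seq nat) :=
  if ps is p :: ps' then
    if miss i k then choose_pile i k.+1 ps' else Some p
  else None.

Definition sort_card (piles : seq (seq nat)) (i : nat) : seq (seq nat) :=
  if choose_pile i 1 (eligible i piles) is Some p
  then (i :: p) :: rem p piles
  else [:: i] :: piles.

Definition patience_piles (deck : seq nat) : seq (seq nat) :=
  foldl sort_card [::] deck.

End patience_sorting.

(* A uniformly shuffled deck of [N] cards, [N] being Poisson([lambda]), together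
   with independent errors of probability [t].  [seq nat] carries the discrete
   sigma-algebra; [deck_uniform] says that, given [N = n], the deck is uniform
   among the [n`!] orderings of [1, ..., n].  The last argument of
   [poisson_prob] is a dummy. *)
Record shuffled_deck (R : realType) (t lambda : R) (d : measure_display)
    (T : measurableType d) (P : probability T R) (N : {RV P >-> nat})
    (deck : T -> seq nat) (miss : nat * nat -> {RV P >-> bool}) : Prop := {
  deck_size_poisson : distribution P N =1 poisson_prob lambda 0%N ;
  deck_cards : forall w, perm_eq (deck w) (iota 1 (N w)) ;
  deck_measurable : forall B : set (seq nat), measurable (deck @^-1` B) ;
  deck_uniform : forall (n : nat) (s : seq nat), perm_eq s (iota 1 n) ->
    P (deck @^-1` [set s]) = (P (N @^-1` [set n]) * (n`!%:R^-1)%:E)%E ;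
  deck_errors :
    bernoulli_coins t (preimage_set_system [set: T] deck [set: set (seq nat)])
      miss }.

Definition number_of_piles (R : realType) (d : measure_display)
    (T : measurableType d) (P : probability T R)
    (deck : T -> seq nat) (miss : nat * nat -> {RV P >-> bool}) (w : T) : nat :=
  size (patience_piles (fun i k => miss (i, k) w) (deck w)).

Section png_dynamics.
Variables (R : realType) (n : nat) (pt : 'I_n -> R * R).
(* [pass i j]: the vertical ray of point [i] and the horizontal ray of point
   [j] pass through each other if they meet. *)
Variable pass : 'I_n -> 'I_n -> bool.

(* In what follows [K i j] means that the vertical ray of [i] and the horizontal
   ray of [j] annihilate each other, which they do at [((pt i).1, (pt j).2)]. *)
Definition vray_reaches (K : rel 'I_n) (i : 'I_n) (b : R) : bool :=
  ((pt i).2 <= b) && [forall j, K i j ==> (b <= (pt j).2)].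

Definition hray_reaches (K : rel 'I_n) (j : 'I_n) (a : R) : bool :=
  ((pt j).1 <= a) && [forall i, K i j ==> (a <= (pt i).1)].

Definition annihilation_rule (K : rel 'I_n) : rel 'I_n := fun i j =>
  [&& i != j, vray_reaches K i (pt j).2, hray_reaches K j (pt i).1
    & ~~ pass i j].

(* The unique fixed point of [annihilation_rule], see [annihilateE] and
   [annihilate_unique]. *)
Definition annihilate : rel 'I_n :=
  iter (n + n) annihilation_rule (fun _ _ => false).

Let rk (i j : 'I_n) : nat :=
  (#|[pred i' : 'I_n | ((pt i').1 < (pt i).1)%R]|
   + #|[pred j' : 'I_n | ((pt j').2 < (pt j).2)%R]|)%N.

Let rk_max i j : (rk i j < n + n)%N.
Proof.
have card_lt (f : 'I_n -> R) k :
    (#|[pred k' : 'I_n | (f k' < f k)%R]| < n)%N.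
  rewrite -[X in (_ < X)%N](card_ord n); apply: proper_card.
  by apply/properP; split; [exact/fintype.subsetP|exists k; rewrite ?inE ?ltxx].
rewrite /rk; have := card_lt (fst \o pt) i; have := card_lt (snd \o pt) j.
by rewrite /=; lia.
Qed.

Let rule_local (K L : rel 'I_n) m :
  (forall i j, (rk i j < m)%N -> K i j = L i j) ->
  forall i j, (rk i j <= m)%N -> annihilation_rule K i j = annihilation_rule L i j.
Proof.
move=> KL i j ijm.
have card_le (f : 'I_n -> R) k l : (f l < f k)%R ->
    (#|[pred k' : 'I_n | (f k' < f l)%R]| < #|[pred k' : 'I_n | (f k' < f k)%R]|)%N.
  move=> lk; apply: proper_card; apply/properP; split.
    by apply/fintype.subsetP => z; rewrite !inE => /lt_trans; apply.
  by exists l; rewrite !inE ?ltxx.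
rewrite /annihilation_rule /vray_reaches /hray_reaches.
congr [&& _, _ && _, _ && _ & _]; apply: eq_forallb => k.
- have [|lt_kj] := leP; first by rewrite !implybT.
  congr (_ ==> _); apply: KL; apply: leq_trans ijm.
  by rewrite /rk ltn_add2l; exact: (card_le (snd \o pt)).
- have [|lt_ki] := leP; first by rewrite !implybT.
  congr (_ ==> _); apply: KL; apply: leq_trans ijm.
  by rewrite /rk ltn_add2r; exact: (card_le (fst \o pt)).
Qed.

Lemma annihilate_unique (K : rel 'I_n) :
  (forall i j, K i j = annihilation_rule K i j) ->
  forall i j, K i j = annihilate i j.
Proof.
move=> KE; suff H m : forall i j, (rk i j < m)%N ->
    K i j = iter m annihilation_rule (fun _ _ => false) i j.
  by move=> i j; exact/H/rk_max.
elim: m => [//|m IH] i j ijm; rewrite KE /=.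
exact: (rule_local IH).
Qed.

Lemma annihilateE i j : annihilate i j = annihilation_rule annihilate i j.
Proof.
pose It m := iter m annihilation_rule (fun _ _ => false).
suff H m : forall i j, (rk i j < m)%N -> It m i j = It m.+1 i j.
  exact/H/rk_max.
elim: m {i j} => [//|m IH] i j ijm.
exact: (rule_local IH).
Qed.

(* The number of horizontal rays intersecting the segment {a} x [0, b]. *)
Definition png_height (a b : R) : nat :=
  #|[pred j : 'I_n | (0 <= (pt j).2 <= b) && hray_reaches annihilate j a]|.

End png_dynamics.

Section poisson_point_process.
Context (R : realType) (d d' : measure_display).
Context (T : measurableType d) (P : probability T R) (S : measurableType d').
(* A point process with finitely many points, enumerated in an arbitrary
   measurable way: the points are the [pt i w] for [i < N w]. *)
Context (N : {RV P >-> nat}) (pt : nat -> {RV P >-> S}).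

Definition point_count (A : set S) (w : T) : nat :=
  (\sum_(i < N w) (pt i w \in A))%N.

Record poisson_point_process (D : set S) (mu : set S -> \bar R) : Prop := {
  ppp_support : forall w i, (i < N w)%N -> D (pt i w) ;
  ppp_poisson : forall A, measurable A -> A `<=` D -> (mu A < +oo)%E ->
    pushforward P (point_count A) =1 poisson_prob (fine (mu A)) 0%N ;
  ppp_independent : forall (m : nat) (A : 'I_m -> set S),
    (forall i, measurable (A i) /\ A i `<=` D) -> trivIset [set: 'I_m] A ->
    mutually_independent P
      (fun i : 'I_m => g_sigma_algebra_preimage (point_count (A i))) }.

Definition point_process_events : set (set T) :=
  <<s g_sigma_algebra_preimage N
      `|` \bigcup_i g_sigma_algebra_preimage (pt i) >>.

End poisson_point_process.

Definition unit_square (R : realType) : set (R * R) := `[0, 1] `*` `[0, 1].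

(* The intensity is [theta ^+ 2].  The vertical ray of a point and the
   horizontal ray of another one meet at most once, so that one coin for each
   ordered pair of points suffices. *)
Record t_PNG (R : realType) (t theta : R) (d : measure_display)
    (T : measurableType d) (P : probability T R) (N : {RV P >-> nat})
    (pt : nat -> {RV P >-> (measurableTypeR R * measurableTypeR R)%type})
    (pass : nat * nat -> {RV P >-> bool}) : Prop := {
  t_PNG_points : poisson_point_process N pt (@unit_square R)
    (fun A => ((theta ^+ 2)%:E * (lebesgue_measure \x lebesgue_measure) A)%E) ;
  t_PNG_coins : bernoulli_coins t (point_process_events N pt) pass }.

Definition t_PNG_height (R : realType) (d : measure_display)
    (T : measurableType d) (P : probability T R) (N : {RV P >-> nat})
    (pt : nat -> {RV P >-> (measurableTypeR R * measurableTypeR R)%type})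
    (pass : nat * nat -> {RV P >-> bool}) (x y : R) (w : T) : nat :=
  @png_height R (N w) (fun i => pt i w) (fun i j => pass (i : nat, j : nat) w)
    x y.

(* Main.v *)
Require Import Defs.
From mathcomp Require Import all_boot all_order all_algebra finmap.
From mathcomp Require Import all_classical all_reals all_analysis.
From mathcomp Require Import ring.

Set Implicit Arguments.
Unset Strict Implicit.
Unset Printing Implicit Defensive.

Import Order.TTheory GRing.Theory Num.Theory.
Import numFieldNormedType.Exports.
Local Open Scope ring_scope.
Local Open Scope classical_set_scope.

(* Sweep the unit square from left to right and keep the heights of the
   horizontal rays alive at the current abscissa.  When a point of height [y] is
   met, its vertical ray meets the rays above [y] in increasing order, each
   meeting being an annihilation with probability [1 - t]; then [y] is added.
   This is a step of patience sorting, the rays playing the role of the top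
   cards, so that the deck is the sequence of the ranks of the heights, read by
   increasing abscissa.  Both models thus evaluate the same decision tree,
   which never asks for the same coin twice, and given the deck the two laws
   agree.

   The law of the deck is only bounded from below: on an M x M grid, the number
   of ways to have [n] points in distinct rows and distinct columns with a
   prescribed deck is ['C(M, n) ^ 2], whatever the deck, and each has
   probability [(theta ^ 2 / M ^ 2) ^ n * exp (- theta ^ 2)].  As M grows this
   tends to [theta ^ (2 n) / n`! ^ 2 * exp (- theta ^ 2)], the probability of
   the deck in patience sorting.  Hence the law of the number of piles is
   dominated by that of the height, and two probability measures, one of which
   dominates the other, are equal. *)

(** * Decision trees and patience sorting *)

Section decision_tree.
Variables (A V : Type).

Inductive dtree : Type := Leaf of V | Ask of A & dtree & dtree.

Fixpoint dtree_eval (c : A -> bool) (u : dtree) : V :=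
  match u with
  | Leaf v => v
  | Ask a u1 u0 => if c a then dtree_eval c u1 else dtree_eval c u0
  end.

(** The probability that the outcome lies in [B] when each question met is answered by a fresh coin,
    true with probability [p]. The first subtree is the one followed on a true answer. *)
Fixpoint dtree_law (R : realType) (p : R) (B : set V) (u : dtree) : R :=
  match u with
  | Leaf v => (v \in B)%:R
  | Ask _ u1 u0 => p * dtree_law p B u1 + (1 - p) * dtree_law p B u0
  end.

(** [f] sends a question to the coin that answers it. Distinct questions may share a coin, so
    freshness is required of the images under [f]; [seen] lists the coins already used on the
    current path. *)
Fixpoint read_once (I : eqType) (f : A -> I) (seen : seq I) (u : dtree) : bool :=
  match u with
  | Leaf _ => true
  | Ask a u1 u0 =>
    [&& f a \notin seen, read_once f (f a :: seen) u1 & read_once f (f a :: seen) u0]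
  end.

End decision_tree.
Arguments Leaf {A V}.

Section game.
Local Open Scope nat_scope.

(* A question [(i, k, e)] asks whether card [i] misses the pile with top card
   [e], the [k]-th pile offered to it. *)
Notation question := (nat * nat * nat)%type.

(** [next] receives the top card of the chosen pile, or [None] when a new pile is started. A
    question carries both [k] and [e] because patience sorting indexes its coins by [k] and the
    t-PNG model by [e]. *)
Fixpoint offer V (i k : nat) (es : seq nat) (next : option nat -> dtree question V) :=
  if es is e :: es' then Ask (i, k, e) (offer i k.+1 es' next) (next (Some e))
  else next None.

Definition place (tops : seq nat) (i : nat) (o : option nat) :=
  i :: (if o is Some e then rem e tops else tops).

Definition eligible_tops (i : nat) (tops : seq nat) :=
  sort leq [seq e <- tops | i < e].

(** Placement depends on the piles only through their top cards, and these are also all that is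
    needed to count piles; hence the state is the list of tops. *)
Fixpoint game (deck tops : seq nat) : dtree question nat :=
  if deck is i :: deck' then
    offer i 1 (eligible_tops i tops) (fun o => game deck' (place tops i o))
  else Leaf (size tops).

Fixpoint pick_top (c : question -> bool) (i k : nat) (es : seq nat) :=
  if es is e :: es' then if c (i, k, e) then pick_top c i k.+1 es' else Some e
  else None.

Lemma eval_offer V c i k es (next : option nat -> dtree question V) :
  dtree_eval c (offer i k es next) = dtree_eval c (next (pick_top c i k es)).
Proof. by elim: es k => //= e es IH k; case: ifP. Qed.

Lemma uniq_place tops i deck o : uniq (tops ++ i :: deck) ->
  uniq (place tops i o ++ deck).
Proof.
rewrite uniq_catC /= uniq_catC => /andP[]; rewrite /place /=.
case: o => [e|]; last by rewrite mem_cat orbC -mem_cat => -> ->.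
rewrite !mem_cat negb_or => /andP[iD iT]; rewrite !cat_uniq => /and3P[uT tD ->].
rewrite negb_or iD andbT (contra (@mem_rem _ _ _ _) iT) rem_uniq//= andbT.
apply: contra tD => /hasP[x xD /mem_rem xT]; apply/hasP; by exists x.
Qed.

Lemma map_rem_uniq (X Y : eqType) (f : X -> Y) s x :
  uniq (map f s) -> x \in s -> map f (rem x s) = rem (f x) (map f s).
Proof.
elim: s => //= a s IH /andP[fas us]; rewrite inE eq_sym.
case: eqVneq => [->|ax]/=; first by rewrite eqxx.
move=> xs; rewrite IH// ifN//; apply: contra fas => /eqP ->.
exact: map_f.
Qed.

(** As the cards are distinct, a pile is determined by its top card, so that removing the chosen
    pile amounts to removing its top from the list of tops. *)
Lemma eval_game_patience (miss : nat -> nat -> bool) deck piles :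
  uniq (map top piles ++ deck) ->
  size (foldl (sort_card miss) piles deck)
  = dtree_eval (fun q => miss q.1.1 q.1.2) (game deck (map top piles)).
Proof.
elim: deck piles => [|i deck IH] piles u /=; first by rewrite size_map.
set c := fun q => _; rewrite eval_offer.
have es : eligible_tops i (map top piles) = map top (eligible i piles).
  by rewrite /eligible_tops /eligible filter_map sort_map.
have pickE ps k : pick_top c i k (map top ps) = omap top (choose_pile miss i k ps).
  by elim: ps k => //= p ps IHp k; rewrite IHp /c /=; case: (miss i k).
have chooseP ps k p : choose_pile miss i k ps = Some p -> p \in ps.
  elim: ps k => //= q ps IHp k; case: ifP => _ => [/IHp|[<-]]; rewrite inE ?eqxx//.
  by move=> ->; rewrite orbT.
have -> : place (map top piles) i (pick_top c i 1 (eligible_tops i (map top piles)))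
    = map top (sort_card miss piles i).
  rewrite es pickE /sort_card /place.
  case E : choose_pile => [p|]//=.
  rewrite map_rem_uniq//; first by move: u; rewrite cat_uniq => /andP[].
  by move: E => /chooseP; rewrite mem_sort mem_filter => /andP[].
apply: IH; have := uniq_place (pick_top c i 1 (eligible_tops i (map top piles))) u.
rewrite es pickE /sort_card /place.
case E : choose_pile => [p|]//=.
rewrite map_rem_uniq//; first by move: u; rewrite cat_uniq => /andP[].
by move: E => /chooseP; rewrite mem_sort mem_filter => /andP[].
Qed.

(** The coin of a question is the pair of [u i] and [v k e]: the second component separates the
    questions of one round, and the coins left behind by the round all have first component [u i].
    This is what [next] may assume about [seen']. *)
Lemma read_once_offer V (J K : eqType) (u : nat -> J) (v : nat -> nat -> K) i k es
    (next : option nat -> dtree question V) seen :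
  uniq [seq v x.1 x.2 | x <- zip (iota k (size es)) es] ->
  {in seen, forall x, x.1 = u i ->
     x.2 \notin [seq v y.1 y.2 | y <- zip (iota k (size es)) es]} ->
  (forall o seen', {in seen', forall x, x \in seen \/ x.1 = u i} ->
     (o : option nat) \in None :: map Some es ->
     read_once (fun q => (u q.1.1, v q.1.2 q.2)) seen' (next o)) ->
  read_once (fun q => (u q.1.1, v q.1.2 q.2)) seen (offer i k es next).
Proof.
elim: es k seen => [|e es IH] k seen /=.
  by move=> _ _; apply; rewrite ?inE// => x; left.
move=> /andP[vk us] hs hn; apply/and3P; split.
- by apply/negP => /hs => /(_ erefl) /=; rewrite inE eqxx.
- apply: IH => // [x|o seen' hs' ho].
    rewrite inE => /predU1P[-> _ //|xs xi].
    by have := hs _ xs xi; rewrite inE negb_or => /andP[].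
  apply: hn => [x /hs'|]; last by move: ho; rewrite !inE;
    case: (o == None) => //= ->; rewrite orbT.
  by rewrite inE => -[/predU1P[->|->]|->]; [right|left|right].
- apply: hn => [x|]; last by rewrite !inE eqxx orbT.
  by rewrite inE => /predU1P[->|]; [right|left].
Qed.

(** Each card is dealt once, so [u] separates the rounds, and [v] separates the offers within a
    round. For patience sorting [v] returns the position [k]; for the t-PNG model it returns the
    point of height rank [e]. *)
Lemma read_once_game (J K : eqType) (u : nat -> J) (v : nat -> nat -> K)
    (D : pred nat) deck tops seen :
  {in D &, injective u} ->
  (forall k es, all D es -> uniq es ->
     uniq [seq v x.1 x.2 | x <- zip (iota k (size es)) es]) ->
  all D deck -> all D tops -> uniq (tops ++ deck) ->
  {in seen, forall x, x.1 \notin map u deck} ->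
  read_once (fun q => (u q.1.1, v q.1.2 q.2)) seen (game deck tops).
Proof.
move=> uinj vu; elim: deck tops seen => //= i deck IH tops seen.
move=> /andP[Di Dd] Dt utd hs; apply: read_once_offer.
- apply: vu; first by apply/allP => x; rewrite mem_sort mem_filter => /andP[_ /(allP Dt)].
  by rewrite sort_uniq filter_uniq//; move: utd; rewrite cat_uniq => /andP[].
- by move=> x /hs + xi; rewrite xi inE eqxx.
- move=> o seen' hs' _; apply: IH => //.
  + rewrite /place /= Di; case: o => // e.
    by apply/allP => x /mem_rem/(allP Dt).
  + exact: uniq_place.
  + move=> x /hs'[/hs|->]; first by rewrite inE negb_or => /andP[].
    apply/mapP => -[y yd uiy]; have /eqP := uinj _ _ Di (allP Dd _ yd) uiy.
    move: utd; rewrite uniq_catC /= mem_cat negb_or => /andP[/andP[+ _] _].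
    by move=> /negP + /eqP iy; rewrite iy.
Qed.

(** When the answers depend on [e] alone, the position [k] disappears and the chosen pile is the one
    with the least top card that is not missed. *)
Lemma pick_topP (c : question -> bool) (b : nat -> bool) i k es e :
  (forall k e, c (i, k, e) = b e) -> sorted ltn es ->
  reflect [/\ e \in es, ~~ b e & forall e', e' \in es -> e' < e -> b e']
    (pick_top c i k es == Some e).
Proof.
move=> cb; elim: es k => [|a es IH] k /= ses.
  by constructor => -[].
have les : all (ltn a) es by apply: order_path_min ses; exact: ltn_trans.
have {IH}/(_ k.+1) := IH _ (path_sorted ses).
rewrite cb; case: ifP => [ba|/negbT ba].
  move=> IH; apply: (iffP IH) => -[es1 be h].
    split=> //; first by rewrite inE es1 orbT.
    by move=> e'; rewrite inE => /predU1P[->//|]; exact: h.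
  move: es1; rewrite inE => /predU1P[ea|es1]; first by rewrite ea ba in be.
  by split=> // e' he'; apply: h; rewrite inE he' orbT.
move=> _; apply: (iffP eqP) => [[<-]|[]].
  split=> //; first by rewrite inE eqxx.
  move=> e'; rewrite inE => /predU1P[->|/(allP les)/= h]; first by rewrite ltnn.
  by move=> /(ltn_trans h); rewrite ltnn.
rewrite inE => /predU1P[->//|ees _ h].
have /(allP les)/= ae := ees.
by have := h a; rewrite inE eqxx (negbTE ba) => /(_ isT ae).
Qed.

End game.

(** * Sweeping the t-PNG model *)

Section deck_of_configuration.
Local Open Scope nat_scope.
Variables (n : nat) (col row : 'I_n -> nat).

(** The count includes [j] itself, so for distinct rows the ranks run from 1 to [n], like the card
    labels. *)
Definition rank (j : 'I_n) : nat := #|[pred i | row i <= row j]|.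

Definition by_column : seq 'I_n := sort (relpre col leq) (enum 'I_n).

Definition deck_of : seq nat := map rank by_column.

Lemma mem_by_column i : i \in by_column.
Proof. by rewrite mem_sort mem_enum. Qed.

Lemma by_column_uniq : uniq by_column.
Proof. by rewrite sort_uniq enum_uniq. Qed.

Lemma by_column_sorted : sorted (relpre col leq) by_column.
Proof. by apply: sort_sorted => i j; exact: leq_total. Qed.

Lemma leq_rank i j : (rank i <= rank j) = (row i <= row j).
Proof.
apply/idP/idP => [|ij]; last first.
  by apply: subset_leq_card; apply/fintype.subsetP => k; rewrite !inE => /leq_trans; apply.
apply: contraTT; rewrite -!ltnNge => ji; apply: proper_card; apply/properP; split.
  by apply/fintype.subsetP => k; rewrite !inE => /leq_trans; apply; exact: ltnW.
by exists i; rewrite !inE ?leqnn// -ltnNge.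
Qed.

Lemma ltn_rank i j : (rank i < rank j) = (row i < row j).
Proof. by rewrite !ltnNge leq_rank. Qed.

Hypothesis row_inj : injective row.

Lemma rank_inj : injective rank.
Proof.
move=> i j ij; apply: row_inj; apply/eqP.
by rewrite eqn_leq -!leq_rank ij leqnn.
Qed.

Lemma deck_of_uniq : uniq deck_of.
Proof. by rewrite map_inj_uniq ?by_column_uniq//; exact: rank_inj. Qed.

End deck_of_configuration.

(** * The annihilations of the t-PNG model as a run of the game *)

Section sweep.
Variables (R : realType) (n : nat) (pt : 'I_n -> R * R).
Variables (pass : nat -> nat -> bool) (col row : 'I_n -> nat).
Hypothesis col_inj : injective col.
Hypothesis row_inj : injective row.
Hypothesis xE : forall i j, ((pt i).1 <= (pt j).1) = (col i <= col j)%N.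
Hypothesis yE : forall i j, ((pt i).2 <= (pt j).2) = (row i <= row j)%N.
Variable idx : nat -> nat.
Hypothesis idxK : forall i, idx (rank row i) = i.

Let K := annihilate pt (fun i j => pass i j).
Let rk := rank row.
Let coin (q : nat * nat * nat) := pass (idx q.1.1) (idx q.2).
(** Points are swept by increasing abscissa and [pre] holds those already met; for [j] in [pre],
    this says that the horizontal ray of [j] has survived so far. *)
Let alive (pre : seq 'I_n) (j : 'I_n) := ~~ has (K^~ j) pre.

Let before pre (i : 'I_n) rest : by_column col = pre ++ i :: rest ->
  forall j, (j \in pre) = (col j < col i)%N.
Proof.
move=> oE j; have trT : transitive (relpre col leq) by move=> ? ? ?; exact: leq_trans.
have := by_column_sorted col; rewrite oE sorted_cat_cons//.
move=> /andP[s1 s2]; have := mem_by_column col j; rewrite oE mem_cat inE.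
have := by_column_uniq col; rewrite oE uniq_catC /= mem_cat negb_or.
move=> /andP[/andP[irest ipre]].
have h1 : j \in pre -> (col j < col i)%N.
  move=> jp; rewrite ltn_neqAle (inj_eq col_inj); apply/andP; split.
    by apply: contra ipre => /eqP <-.
  have : sorted (relpre col leq) (rcons pre i) by rewrite s1.
  rewrite -[rcons _ _]cats1 (sorted_pairwise trT) pairwise_cat allrel1r => /and3P[+ _ _].
  by move=> /allP/(_ _ jp).
have h2 : j \in rest -> (col i <= col j)%N.
  by move: s2; rewrite /= (path_sortedE trT) => /andP[/allP h _] /h.
move=> _ /or3P[jp|/eqP->|jr]; first by rewrite jp h1.
- by rewrite ltnn; apply/negbTE.
- by rewrite ltnNge h2//=; apply/negP => /h1; rewrite ltnNge h2.
Qed.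

(** The eligible tops are the live rays that start to the left of [i] and above it. By the
    fixed-point equation [annihilateE], the vertical ray of [i] is annihilated by the lowest of them
    that it does not pass through, which is the choice described by [pick_topP]. *)
Let pick_annihilate pre i rest tops :
  by_column col = pre ++ i :: rest -> uniq tops ->
  tops =i map rk [seq j <- pre | alive pre j] ->
  forall j, (pick_top coin (rk i) 1 (eligible_tops (rk i) tops) == Some (rk j))
            = K i j.
Proof.
move=> oE ut tE; set es := eligible_tops _ _.
have ses : sorted ltn es.
  by rewrite ltn_sorted_uniq_leq sort_uniq filter_uniq//= sort_sorted//; exact: leq_total.
have esE j : (rk j \in es) = [&& (row i < row j)%N, (col j < col i)%N & alive pre j].
  rewrite mem_sort mem_filter tE (mem_map (rank_inj row_inj)).
  by rewrite ltn_rank mem_filter (before oE) [alive _ _ && _]andbC.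
have Kes j : K i j -> (rk j \in es) && ~~ pass i j.
  rewrite /K annihilateE => /and4P[ij /andP[yij _] /andP[xji /forallP h] ->].
  rewrite andbT esE; move: yij xji; rewrite xE yE => yij xji.
  rewrite ltn_neqAle (inj_eq row_inj) ij yij ltn_neqAle (inj_eq col_inj) eq_sym ij xji /=.
  apply/hasPn => k; rewrite (before oE) => kp; apply/negP => Kkj.
  by have := h k; rewrite -/K Kkj xE leqNgt kp.
move=> j.
apply/(pick_topP (b := fun e => pass i (idx e)))/idP => //.
- by move=> k e; rewrite /coin /= idxK.
- move=> [jes]; rewrite idxK => pij h; rewrite /K annihilateE.
  move: jes; rewrite esE => /and3P[yij xji /hasPn aj].
  rewrite /annihilation_rule /vray_reaches /hray_reaches pij andbT.
  rewrite yE xE (ltnW yij) (ltnW xji) /=; apply/and3P; split.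
  + by apply: contraTneq yij => ->; rewrite ltnn.
  + apply/forallP => k; apply/implyP => Kik; rewrite yE leqNgt; apply/negP => kj.
    have /andP[kes /negP] := Kes _ Kik; apply.
    by have := h _ kes; rewrite ltn_rank idxK; apply.
  + apply/forallP => k; apply/implyP => Kkj; rewrite xE leqNgt; apply/negP => ki.
    by move: Kkj; apply/negP/aj; rewrite (before oE).
- move=> Kij; have /andP[jes pij] := Kes _ Kij.
  split=> //; first by rewrite idxK.
  move=> e ees ej; have [k ek] : exists k, e = rk k.
    move: ees; rewrite mem_sort mem_filter tE => /andP[_ /mapP[k _ ->]].
    by exists k.
  rewrite ek idxK; apply/negPn/negP => pik.
  move: ees ej; rewrite ek ltn_rank esE => /and3P[yik xki /hasPn ak] kj.
  (* Annihilation with the lower ray [k] would stop the vertical ray of [i] below the height of [j],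
     contradicting [K i j]. *)
  suff Kik : K i k.
    have : K i j := Kij; rewrite /K annihilateE => /and4P[_ /andP[_ /forallP h] _ _].
    by have := h k; rewrite -/K Kik yE leqNgt kj.
  rewrite /K annihilateE /annihilation_rule /vray_reaches /hray_reaches pik andbT.
  rewrite yE xE (ltnW yik) (ltnW xki) /=; apply/and3P; split.
  + by apply: contraTneq yik => ->; rewrite ltnn.
  + apply/forallP => l; apply/implyP => Kil; apply: le_trans (_ : (pt j).2 <= _).
      by rewrite yE ltnW.
    have : K i j := Kij; rewrite /K annihilateE => /and4P[_ /andP[_ /forallP h] _ _].
    by have := h l; rewrite Kil.
  + apply/forallP => l; apply/implyP => Kkl; rewrite xE leqNgt; apply/negP => li.
    by move: Kkl; apply/negP/ak; rewrite (before oE).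
Qed.

(** The invariant of the sweep: the tops are the ranks of the live rays, as sets. Once all points
    are swept, the tops are the rays that are never annihilated. *)
Let eval_game_alive rest pre tops :
  by_column col = pre ++ rest -> uniq tops ->
  tops =i map rk [seq j <- pre | alive pre j] ->
  dtree_eval coin (game (map rk rest) tops) = #|[pred j | [forall i, ~~ K i j]]|.
Proof.
elim: rest pre tops => [|i rest IH] pre tops oE ut tE /=.
  move: oE; rewrite cats0 => oE.
  have upre : uniq pre by rewrite -oE by_column_uniq.
  rewrite (_ : size tops = size [seq j <- pre | alive pre j]); last first.
    rewrite -[RHS](size_map rk); apply: perm_size; apply: uniq_perm => //.
    by rewrite (map_inj_uniq (rank_inj row_inj)) filter_uniq.
  rewrite -(card_uniqP (filter_uniq _ upre)); apply: eq_card => j.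
  rewrite mem_filter inE -oE mem_by_column andbT /alive.
  apply/hasPn/forallP => [h k|h k _]; last exact: h.
  by apply: h; exact: mem_by_column.
rewrite eval_offer.
have pickK := pick_annihilate oE ut tE.
have utd : uniq (tops ++ map rk (i :: rest)).
  have : uniq (map rk (pre ++ i :: rest)).
    by rewrite (map_inj_uniq (rank_inj row_inj)) -oE by_column_uniq.
  rewrite map_cat !cat_uniq ut => /and3P[_ /hasPn h ->].
  rewrite andbT; apply/hasPn => x /h; apply: contra; rewrite tE => /mapP[j + ->].
  by rewrite mem_filter => /andP[_ jp]; apply: map_f.
have u' := uniq_place (pick_top coin (rk i) 1 (eligible_tops (rk i) tops)) utd.
apply: (IH (rcons pre i)); first by rewrite cat_rcons.
  by move: u'; rewrite cat_uniq => /andP[].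
have aliveE j : alive (rcons pre i) j = alive pre j && ~~ K i j.
  by rewrite /alive has_rcons negb_or andbC.
(* The ray just added is alive: a point does not annihilate with itself, and the points of [pre] lie
   strictly to the left of where this ray begins. *)
have ai : alive (rcons pre i) i.
  apply/hasPn => k; rewrite mem_rcons inE => /predU1P[->|kp].
    by rewrite /K annihilateE /annihilation_rule eqxx.
  rewrite /K annihilateE; apply/negP => /and4P[_ _ /andP[+ _] _].
  by rewrite xE leqNgt -(before oE) kp.
set P := [seq j <- rcons pre i | _].
have memP j : j \in P = (j == i) || [&& j \in pre, alive pre j & ~~ K i j].
  rewrite mem_filter mem_rcons inE; case: eqVneq => [->|_]/=; first by rewrite ai.
  by rewrite aliveE andbC.
move=> x; rewrite /place inE.
have remE : x \in (if pick_top coin (rk i) 1 (eligible_tops (rk i) tops) is Some e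
    then rem e tops else tops)
  = (x \in tops) && (pick_top coin (rk i) 1 (eligible_tops (rk i) tops) != Some x).
  case: pick_top => [e|]; last by rewrite andbT.
  by rewrite mem_rem_uniq// inE andbC eq_sym.
rewrite {}remE tE; apply/idP/mapP.
  case/predU1P => [->|/andP[/mapP[j jp ->]]].
    by exists i; rewrite ?memP ?eqxx.
  rewrite pickK => Kij; exists j => //; rewrite memP Kij andbT.
  by move: jp; rewrite mem_filter andbC => ->; rewrite orbT.
case=> j + ->; rewrite memP => /predU1P[->|/and3P[jp aj Kij]]; first by rewrite eqxx.
by rewrite pickK Kij andbT map_f ?orbT// mem_filter aj.
Qed.

(** A ray annihilated exactly at abscissa 1 would still count as reaching 1. With all abscissae
    strictly below 1, the rays counted are those that are never annihilated. *)
Lemma eval_game_png_height :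
  (forall i, [&& (pt i).1 < 1, 0 <= (pt i).2 & (pt i).2 <= 1]) ->
  dtree_eval (fun q : nat * nat * nat => pass (idx q.1.1) (idx q.2))
    (game (deck_of col row) [::]) = png_height pt (fun i j => pass i j) 1 1.
Proof.
move=> sq; rewrite (@eval_game_alive _ [::])//.
apply: eq_card => j; rewrite !inE /hray_reaches.
have /and3P[/ltW -> -> ->] := sq j; rewrite /=.
apply: eq_forallb => i; rewrite -/K; case: (K i j) => //=.
by have /and3P[+ _ _] := sq i; rewrite ltNge => /negbTE ->.
Qed.

End sweep.

(** * Decision trees with independent coins *)

Lemma mutually_independent_seq (R : realType) (d : measure_display)
    (T : measurableType d) (P : probability T R) (I : choiceType)
    (F : I -> set (set T)) (E : I -> set T) (l : seq I) :
  mutually_independent P F -> uniq l -> (forall i, i \in l -> F i (E i)) ->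
  P (\bigcap_(i in [set` l]) E i) = (\prod_(i <- l) P (E i))%E.
Proof.
move=> indep ul FE.
have lE : [set` l] = [set` [fset x in l]%fset].
  by apply/seteqP; split=> i /=; rewrite in_fset.
rewrite lE indep => [|i]; last by rewrite in_fset; exact: FE.
apply: perm_big; apply: uniq_perm => // i; exact: in_fset.
Qed.

Lemma uniq_map_inj_in (X Y : eqType) (f : X -> Y) (s : seq X) :
  uniq (map f s) -> {in s &, injective f}.
Proof.
elim: s => //= a s IH /andP[fas us] x y; rewrite !inE.
move=> /predU1P[->|xs] /predU1P[->|ys]// fxy.
- by rewrite fxy map_f in fas.
- by rewrite -fxy map_f in fas.
- exact: IH.
Qed.

Section coins.
Variables (R : realType) (p : R) (d : measure_display) (T : measurableType d).
Variables (P : probability T R) (G : set (set T)) (I : choiceType).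
Variable c : I -> {RV P >-> bool}.
Hypothesis p01 : 0 <= p <= 1.
Hypothesis coins : bernoulli_coins p G c.

Lemma bernoulli_coinE i b : P (c i @^-1` [set b]) = (bernoulli_pmf p b)%:E.
Proof.
have [/(_ i) cE _] := coins; have := cE [set b].
by rewrite /distribution /= /pushforward => ->; rewrite /bernoulli_prob p01 fsbig_set1.
Qed.

Lemma measurable_coin i b : measurable [set w | c i w = b].
Proof. by have := measurable_funP (c i) measurableT [set b] Logic.I; rewrite setTI. Qed.

Let tree_eventE A V (f : A -> I) (B : set V) a u1 u0 :
  [set w | B (dtree_eval (fun a => c (f a) w) (Ask a u1 u0))]
  = [set w | c (f a) w = true] `&` [set w | B (dtree_eval (fun a => c (f a) w) u1)] `|`
    [set w | c (f a) w = false] `&` [set w | B (dtree_eval (fun a => c (f a) w) u0)].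
Proof.
apply/seteqP; split=> w /=; first by case: (c (f a) w); [left|right].
by move=> [[->]|[->]].
Qed.

Lemma measurable_dtree_event A V (f : A -> I) (B : set V) u :
  measurable [set w | B (dtree_eval (fun a => c (f a) w) u)].
Proof.
elim: u => [v|a u1 m1 u0 m0].
  have [Bv|Bv] := pselect (B v).
    by rewrite (_ : [set _ | _] = setT)//; apply/seteqP; split.
  by rewrite (_ : [set _ | _] = set0)//; apply/seteqP; split.
by rewrite tree_eventE; apply: measurableU; apply: measurableI => //; exact: measurable_coin.
Qed.

Variable E : set T.
Hypothesis GE : G E.
Hypothesis mE : measurable E.

Let outcomes (l : seq (I * bool)) := E `&` [set w | all (fun x => c x.1 w == x.2) l].

Let measurable_outcomes l : measurable (outcomes l).
Proof.
apply: measurableI => //; elim: l => [|x l IH] /=.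
  by rewrite (_ : [set _ | true] = setT)//; apply/seteqP; split.
rewrite (_ : [set _ | _] = [set w | c x.1 w = x.2] `&`
    [set w | all (fun x => c x.1 w == x.2) l]).
  by apply: measurableI => //; exact: measurable_coin.
by apply/seteqP; split=> w /= => [/andP[/eqP]|[-> ->]]; rewrite ?eqxx.
Qed.

Let prob_outcomes l : uniq (map fst l) ->
  P (outcomes l) = (P E * (\prod_(x <- l) bernoulli_pmf p x.2)%:E)%E.
Proof.
move=> ul; have [_ indep] := coins.
(* Since the keys of [l] are distinct, the pair of [i] and [c i w] lies in [l] exactly when coin [i]
   shows the value recorded for it. This defines the event from the index alone. *)
pose F (o : option I) := if o is Some i then [set w | (i, c i w) \in l] else E.
have FE x : x \in l -> F (Some x.1) = [set w | c x.1 w = x.2].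
  move=> xl; apply/seteqP; split=> w /=; last by move=> ->; rewrite -surjective_pairing.
  by move=> h; have := uniq_map_inj_in ul h xl erefl; case: (x) => ? ? [].
have -> : outcomes l = \bigcap_(o in [set` None :: map Some (map fst l)]) F o.
  apply/seteqP; split=> w /=.
    move=> [Ew /allP h] o /=; rewrite inE => /predU1P[->//|/mapP[_ /mapP[x xl ->] ->]].
    by rewrite FE//=; apply/eqP/h.
  move=> h; split; first by have := h None; rewrite /= inE eqxx; apply.
  apply/allP => x xl; apply/eqP; have := h (Some x.1).
  by rewrite FE//; apply; rewrite /= inE map_f ?orbT//; apply: map_f.
rewrite (mutually_independent_seq indep).
- rewrite big_cons !big_map -prodEFin; congr (_ * _)%E.
  by apply: eq_big_seq => x xl; rewrite FE//; exact: bernoulli_coinE.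
- by rewrite /= map_inj_uniq ?ul ?andbT; [apply/mapP => -[]|move=> ? ? []].
- move=> o; rewrite inE => /predU1P[->//|/mapP[_ /mapP[x xl ->] ->]].
  by rewrite FE//; exists [set x.2] => //; rewrite setTI.
Qed.

Let outcomesI l q b X :
  outcomes l `&` ([set w | c q w = b] `&` X) = outcomes ((q, b) :: l) `&` X.
Proof.
apply/seteqP; split=> w /=.
  by move=> [[Ew h] [<- Xw]]; split=> //; split=> //=; rewrite eqxx.
by move=> [[Ew /andP[/eqP ? h]] Xw].
Qed.

(** Induction on the tree, for every history [l] of known outcomes: a question splits the event into
    two disjoint ones with longer histories, whose keys remain distinct because the coin asked is
    fresh. *)
Let prob_outcomes_dtree A V (f : A -> I) (B : set V) u l :
  uniq (map fst l) -> read_once f (map fst l) u ->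
  P (outcomes l `&` [set w | B (dtree_eval (fun a => c (f a) w) u)])
  = (P E * ((\prod_(x <- l) bernoulli_pmf p x.2) * dtree_law p B u)%:E)%E.
Proof.
elim: u l => [v|a u1 IH1 u0 IH0] l ul.
  move=> _ /=; have [Bv|Bv] := pselect (B v).
    rewrite mem_set// mulr1 (_ : [set _ | _] = setT); last by apply/seteqP; split.
    by rewrite setIT prob_outcomes.
  rewrite memNset// mulr0 mule0 (_ : [set _ | _] = set0) ?setI0 ?measure0//.
  by apply/seteqP; split.
move=> /= /and3P[al o1 o0]; rewrite tree_eventE setIUr !outcomesI measureU.
- rewrite [X in (X + _)%E](IH1 ((f a, true) :: l));
    rewrite ?[X in (_ + X)%E](IH0 ((f a, false) :: l))/= ?al ?ul//.
  rewrite !big_cons /= -(fineK (fin_num_measure P E mE)).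
  by rewrite -!EFinM -EFinD; congr EFin; ring.
- by apply: measurableI => //; exact: measurable_dtree_event.
- by apply: measurableI => //; exact: measurable_dtree_event.
- apply/seteqP; split=> w //= [[[_ /andP[/eqP ca _]] _] [[_ /andP[/eqP]]]].
  by rewrite /= ca.
Qed.

Lemma prob_dtree A V (f : A -> I) (B : set V) u : read_once f [::] u ->
  P (E `&` [set w | B (dtree_eval (fun a => c (f a) w) u)])
  = (P E * (dtree_law p B u)%:E)%E.
Proof.
move=> ou; have := @prob_outcomes_dtree A V f B u [::] isT ou.
rewrite big_nil mul1r => <-; congr (P (_ `&` _)).
by apply/seteqP; split=> w //= -[].
Qed.

End coins.

(** * Measurability *)

Section discrete_measurability.
Variables (d : measure_display) (T : measurableType d).

(** Measurability for the discrete sigma-algebra on [X], stated without putting a measurable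
    structure on [X]. *)
Definition dmeasurable (X : Type) (g : T -> X) : Prop :=
  forall Y : set X, measurable (g @^-1` Y).

Lemma dmeasurable_cst (X : Type) (x : X) : dmeasurable (fun=> x).
Proof.
move=> Y; have [Yx|Yx] := pselect (Y x).
  by rewrite (_ : _ @^-1` _ = setT)//; apply/seteqP; split.
by rewrite (_ : _ @^-1` _ = set0)//; apply/seteqP; split.
Qed.

(** Cutting along the countably many values of [g] freezes a random parameter, such as the deck or
    the number of points on which the type ['I_n] depends. *)
Lemma dmeasurable_select (X : countType) (Z : Type) (g : T -> X) (F : X -> T -> Z) :
  dmeasurable g -> (forall x, dmeasurable (F x)) ->
  dmeasurable (fun w => F (g w) w).
Proof.
move=> mg mF Y.
rewrite (_ : _ @^-1` _ = \bigcup_x (g @^-1` [set x] `&` F x @^-1` Y)).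
  apply: countable_bigcupT_measurable => [|x]; first exact: countableP.
  by apply: measurableI; [exact: mg|exact: mF].
apply/seteqP; split=> w /=; first by move=> Yw; exists (g w).
by move=> [x _ [<-]].
Qed.

Lemma dmeasurable_comp (X : countType) (Z : Type) (h : X -> Z) (g : T -> X) :
  dmeasurable g -> dmeasurable (h \o g).
Proof.
move=> mg; apply: (dmeasurable_select (F := fun x _ => h x) mg) => x.
exact: dmeasurable_cst.
Qed.

Lemma dmeasurable_comp2 (X Y : countType) (Z : Type) (h : X -> Y -> Z) f g :
  dmeasurable f -> dmeasurable g -> dmeasurable (fun w => h (f w) (g w)).
Proof.
move=> mf mg; apply: (dmeasurable_select (F := fun x w => h x (g w)) mf) => x.
exact: (dmeasurable_comp (h x) mg).
Qed.

(** A finite family with countable values becomes one variable with countable values, so that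
    quantifiers, cardinals and sums over [J] are treated by composition. *)
Lemma dmeasurable_ffun (J : finType) (X : countType) (F : J -> T -> X) :
  (forall j, dmeasurable (F j)) -> dmeasurable (fun w => [ffun j => F j w]).
Proof.
move=> mF Y; rewrite (_ : _ @^-1` _ =
    \bigcup_(u in Y) \bigcap_(j in [set: J]) (F j @^-1` [set u j])); last first.
  apply/seteqP; split=> w /=.
    by move=> Yw; exists [ffun j => F j w] => //= j _ /=; rewrite ffunE.
  move=> [u Yu h]; rewrite (_ : finfun _ = u)//.
  by apply/ffunP => j; rewrite ffunE; exact: h.
rewrite bigcup_mkcond; apply: countable_bigcupT_measurable => [|u].
  exact: countableP.
case: ifP => // _; apply: fin_bigcap_measurable => // j _; exact: mF.
Qed.

Lemma dmeasurable_forall (J : finType) (F : J -> T -> bool) :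
  (forall j, dmeasurable (F j)) -> dmeasurable (fun w => [forall j, F j w]).
Proof.
move=> /dmeasurable_ffun/(dmeasurable_comp (fun u : {ffun J -> bool} => [forall j, u j])).
by congr dmeasurable; apply/funext => w /=; apply: eq_forallb => j; rewrite ffunE.
Qed.

Lemma dmeasurable_card (J : finType) (F : J -> T -> bool) :
  (forall j, dmeasurable (F j)) -> dmeasurable (fun w => #|[pred j | F j w]|).
Proof.
move=> /dmeasurable_ffun/(dmeasurable_comp (fun u : {ffun J -> bool} => #|[pred j | u j]|)).
by congr dmeasurable; apply/funext => w /=; apply: eq_card => j; rewrite !inE ffunE.
Qed.

Lemma dmeasurable_sum (J : finType) (F : J -> T -> nat) :
  (forall j, dmeasurable (F j)) -> dmeasurable (fun w => \sum_j F j w)%N.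
Proof.
move=> /dmeasurable_ffun/(dmeasurable_comp (fun u : {ffun J -> nat} => \sum_j u j)%N).
by congr dmeasurable; apply/funext => w /=; apply: eq_bigr => j _; rewrite ffunE.
Qed.

Lemma measurable_fun_nat (g : T -> nat) : dmeasurable g -> measurable_fun setT g.
Proof. by move=> mg _ Y _; rewrite setTI. Qed.

Lemma dmeasurable_nat (g : T -> nat) : measurable_fun setT g -> dmeasurable g.
Proof. by move=> mg Y; rewrite -[X in measurable X]setTI; exact: mg. Qed.

Lemma dmeasurable_bool (g : T -> bool) : measurable_fun setT g -> dmeasurable g.
Proof. by move=> mg Y; rewrite -[X in measurable X]setTI; exact: mg. Qed.

End discrete_measurability.

Section measurability.
Variables (R : realType) (d : measure_display) (T : measurableType d).
Variable P : probability T R.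

Lemma dmeasurable_number_of_piles (deck : T -> seq nat) (miss : nat * nat -> {RV P >-> bool}) :
  dmeasurable deck -> (forall w, uniq (deck w)) ->
  dmeasurable (number_of_piles deck miss).
Proof.
move=> mdeck udeck.
rewrite (_ : number_of_piles deck miss = fun w =>
    dtree_eval (fun q => miss (q.1.1, q.1.2) w) (game (deck w) [::])); last first.
  by apply/funext => w; exact: (@eval_game_patience (fun i k => miss (i, k) w) _ [::] (udeck w)).
pose F s w := dtree_eval (fun q => miss (q.1.1, q.1.2) w) (game s [::]).
apply: (dmeasurable_select (F := F) mdeck) => s Y.
exact: (measurable_dtree_event miss (fun q => (q.1.1, q.1.2)) Y (game s [::])).
Qed.

Variables (N : {RV P >-> nat}).

Lemma dmeasurable_point_count (d' : measure_display) (S : measurableType d')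
    (pt : nat -> {RV P >-> S}) (A : set S) :
  measurable A -> dmeasurable (point_count N pt A).
Proof.
move=> mA; pose F n w := (\sum_(i < n) (pt i w \in A))%N.
apply: (dmeasurable_select (F := F) (dmeasurable_nat _)) => [//|n].
apply: dmeasurable_sum => i.
apply: (dmeasurable_comp nat_of_bool); apply: dmeasurable_bool.
apply: (measurable_fun_bool true) => //.
have := measurable_funP (pt i) measurableT A mA; congr measurable.
by apply/seteqP; split=> w /= -[_ h]; split=> //; [apply/mem_set|apply/set_mem].
Qed.

Variable pt : nat -> {RV P >-> (measurableTypeR R * measurableTypeR R)%type}.
Variable pass : nat * nat -> {RV P >-> bool}.

Let x i w : R := (pt i w).1.
Let y i w : R := (pt i w).2.

Let mx i : measurable_fun setT (x i).
Proof. by apply: measurableT_comp; [exact: measurable_fst|exact: measurable_funP]. Qed.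

Let my i : measurable_fun setT (y i).
Proof. by apply: measurableT_comp; [exact: measurable_snd|exact: measurable_funP]. Qed.

Let dle (f g : T -> R) : measurable_fun setT f -> measurable_fun setT g ->
  dmeasurable (fun w => f w <= g w).
Proof.
move=> mf mg; apply: dmeasurable_bool.
exact: measurable_realfun.measurable_fun_ler.
Qed.

Let dand (f g : T -> bool) : dmeasurable f -> dmeasurable g ->
  dmeasurable (fun w => f w && g w).
Proof. exact: dmeasurable_comp2. Qed.

Let dimp (f g : T -> bool) : dmeasurable f -> dmeasurable g ->
  dmeasurable (fun w => f w ==> g w).
Proof. exact: dmeasurable_comp2. Qed.

Let dhray n (K : T -> rel 'I_n) j (a : T -> R) : measurable_fun setT a ->
  (forall i j, dmeasurable (fun w => K w i j)) ->
  dmeasurable (fun w => hray_reaches (fun i => pt i w) (K w) j (a w)).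
Proof.
move=> ma mK; apply: dand; first exact: (dle (mx j) ma).
by apply: dmeasurable_forall => i; apply: dimp => //; exact: (dle ma (mx i)).
Qed.

Let dannihilate n i j : dmeasurable (fun w =>
  annihilate (fun i : 'I_n => pt i w) (fun i j => pass (i : nat, j : nat) w) i j).
Proof.
rewrite /annihilate; elim: (n + n)%N i j => [|m IH] i j /=.
  exact: dmeasurable_cst.
rewrite /annihilation_rule; apply: dand; first exact: dmeasurable_cst.
apply: dand; last apply: dand.
- apply: dand; first exact: (dle (my i) (my j)).
  by apply: dmeasurable_forall => k; apply: dimp => //; exact: (dle (my j) (my k)).
- exact: (dhray j (mx i)).
- by apply: (dmeasurable_comp negb); apply: dmeasurable_bool; exact: measurable_funP.
Qed.

Lemma dmeasurable_t_PNG_height a b : dmeasurable (t_PNG_height N pt pass a b).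
Proof.
pose F n w := @png_height R n (fun i => pt i w) (fun i j => pass (i : nat, j : nat) w) a b.
apply: (dmeasurable_select (F := F) (dmeasurable_nat _)) => [//|n].
have mc (r : R) : measurable_fun [set: T] (fun=> r) by exact: measurable_cst.
apply: dmeasurable_card => j; apply: dand.
  by apply: dand; [exact: (dle (mc 0) (my j))|exact: (dle (my j) (mc b))].
exact: (dhray j (mc a)).
Qed.

End measurability.

(** * Points on a grid *)

Lemma measure_seq_bigcup (R : realType) (d : measure_display) (T : measurableType d)
    (mu : {measure set T -> \bar R}) (I : choiceType) (r : seq I) (F : I -> set T) :
  uniq r -> trivIset [set` r] F -> (forall i, measurable (F i)) ->
  mu (\bigcup_(i in [set` r]) F i) = (\sum_(i <- r) mu (F i))%E.
Proof.
move=> ur tF mF; rewrite (fsbig_seq _ _ ur).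
by rewrite (measure_fin_bigcup mu).
Qed.

Section grid.
Variables (R : realType) (M : nat).
Hypothesis M_gt0 : (0 < M)%N.

(** Half-open intervals make distinct cells disjoint and keep the points of the cells [a < M]
    strictly below 1. *)
Definition cell (a : nat) : set R :=
  [set x | a%:R / M%:R <= x < a.+1%:R / M%:R].

Let cellE a : cell a = `[a%:R / M%:R, a.+1%:R / M%:R[%classic.
Proof. by rewrite set_itvco. Qed.

Definition box (ab : nat * nat) : set (R * R) := cell ab.1 `*` cell ab.2.

Let M_gt0R : 0 < M%:R^-1 :> R. Proof. by rewrite invr_gt0 ltr0n. Qed.

Lemma cell_lt a b x y : cell a x -> cell b y -> (a < b)%N -> x < y.
Proof.
rewrite /cell /= => /andP[_ xa] /andP[yb _] ab.
apply: lt_le_trans xa _; apply: le_trans yb.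
by rewrite ler_pM2r// ler_nat.
Qed.

Lemma cell_inj a b x : cell a x -> cell b x -> a = b.
Proof.
move=> ax bx; case: (ltngtP a b) => // h.
  by have := cell_lt ax bx h; rewrite ltxx.
by have := cell_lt bx ax h; rewrite ltxx.
Qed.

Lemma box_inj ab ab' z : box ab z -> box ab' z -> ab = ab'.
Proof.
case: ab ab' => [a b] [a' b'] [/= az bz] [/= az' bz'].
by rewrite (cell_inj az az') (cell_inj bz bz').
Qed.

Lemma cell_unit a x : (a < M)%N -> cell a x -> 0 <= x < 1.
Proof.
rewrite /cell /= => aM /andP[ax xa]; apply/andP; split.
  by apply: le_trans ax; rewrite mulr_ge0// ltW.
apply: lt_le_trans xa _; rewrite ler_pdivrMr ?ltr0n// mul1r ler_nat.
exact: aM.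
Qed.

Lemma box_unit_square a b : (a < M)%N -> (b < M)%N ->
  box (a, b) `<=` @unit_square R.
Proof.
move=> aM bM z [/= /(cell_unit aM)/andP[z1 /ltW z1'] /(cell_unit bM)/andP[z2 /ltW z2']].
by split; rewrite /= in_itv /= ?z1 ?z2.
Qed.

Lemma measurable_box ab :
  measurable (box ab : set (measurableTypeR R * measurableTypeR R)).
Proof. by apply: measurableX; rewrite cellE; exact: measurable_itv. Qed.

Lemma lebesgue_box ab :
  (lebesgue_measure \x lebesgue_measure)%E
    (box ab : set (measurableTypeR R * measurableTypeR R)) = (M%:R ^- 2)%:E.
Proof.
have cellm a : lebesgue_measure (cell a) = (M%:R^-1)%:E.
  rewrite cellE lebesgue_measure_itv /= lte_fin ltr_pM2r// ltr_nat ltnSn.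
  by rewrite -EFinD -mulrBl -natrB// subSnn mul1r.
rewrite product_measure1E; [|by rewrite cellE; exact: measurable_itv..].
by rewrite [X in (X * _)%E](cellm ab.1) [X in (_ * X)%E](cellm ab.2) -EFinM -invfM -expr2.
Qed.

Lemma lebesgue_unit_square :
  (lebesgue_measure \x lebesgue_measure)%E
    (@unit_square R : set (measurableTypeR R * measurableTypeR R)) = 1%E.
Proof.
have m01 : lebesgue_measure (`[0, 1]%classic : set R) = 1%E.
  by rewrite lebesgue_measure_itv /= lte_fin ltr01 sube0.
rewrite product_measure1E; [|exact: measurable_itv..].
by rewrite [X in (X * _)%E]m01 [X in (_ * X)%E]m01 mule1.
Qed.

End grid.

(** * The height given the grid cells of the points *)

Section png_on_grid.
Variables (R : realType) (t theta : R) (d : measure_display) (T : measurableType d).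
Variables (P : probability T R) (N : {RV P >-> nat}).
Variable pt : nat -> {RV P >-> (measurableTypeR R * measurableTypeR R)%type}.
Variable pass : nat * nat -> {RV P >-> bool}.
Hypothesis t01 : 0 <= t <= 1.
Hypothesis hPNG : t_PNG t theta N pt pass.
Variable M : nat.
Hypothesis M_gt0 : (0 < M)%N.

(** The column and the row of each of [n] labelled points in an [M] by [M] grid. *)
Definition config n := ({ffun 'I_n -> 'I_M} * {ffun 'I_n -> 'I_M})%type.

Definition config_deck n (cr : config n) : seq nat :=
  deck_of (fun i => cr.1 i : nat) (fun i => cr.2 i : nat).

(** Distinct columns and distinct rows let the grid decide the order of all coordinates, hence the
    deck. *)
Definition configs n (s : seq nat) : pred (config n) :=
  fun cr => [&& injectiveb cr.1, injectiveb cr.2 & config_deck cr == s].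

Definition in_config n (cr : config n) : set T :=
  [set w | N w = n /\ forall i : 'I_n, @box R M (cr.1 i : nat, cr.2 i : nat) (pt i w)].

(** The label of the point whose height has rank [e]: the inverse of [rank] asked for by the
    sweep. *)
Definition card_index n (cr : config n) (e : nat) : nat :=
  index e (map (rank (fun i => cr.2 i : nat)) (enum 'I_n)).

Lemma in_configE n (cr : config n) :
  in_config cr = (N @^-1` [set n]) `&`
    \bigcap_(i in [set: 'I_n]) (pt i @^-1` @box R M (cr.1 i : nat, cr.2 i : nat)).
Proof.
apply/seteqP; split=> w /=; first by move=> [? h]; split=> // i _; exact: h.
by move=> [? h]; split=> // i; exact: h.
Qed.

Lemma measurable_in_config n (cr : config n) : measurable (in_config cr).
Proof.
rewrite in_configE; apply: measurableI.
  by have := measurable_funP N measurableT [set n] Logic.I; rewrite setTI.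
apply: fin_bigcap_measurable => // i _.
have := measurable_funP (pt i) measurableT _ (measurable_box M (cr.1 i : nat, cr.2 i : nat)).
by rewrite setTI.
Qed.

Lemma in_config_event n (cr : config n) : point_process_events N pt (in_config cr).
Proof.
pose GT := g_sigma_algebraType (g_sigma_algebra_preimage N
      `|` \bigcup_i g_sigma_algebra_preimage (pt i)).
suff : measurable (in_config cr : set GT) by [].
rewrite in_configE; apply: measurableI.
  by apply: sub_sigma_algebra; left; exists [set n] => //; rewrite setTI.
apply: fin_bigcap_measurable => // i _.
apply: sub_sigma_algebra; right; exists (i : nat) => //.
exists (@box R M (cr.1 i : nat, cr.2 i : nat)); last by rewrite setTI.
exact: measurable_box.
Qed.

Let idxK n (cr : config n) (i : 'I_n) : injective cr.2 ->
  card_index cr (rank (fun i => cr.2 i : nat) i) = i.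
Proof.
move=> ri; rewrite /card_index index_map ?index_enum_ord//.
by apply: rank_inj => j k /val_inj/ri.
Qed.

Lemma height_in_config n s (cr : config n) w : configs s cr -> in_config cr w ->
  t_PNG_height N pt pass 1 1 w =
  dtree_eval (fun q : nat * nat * nat =>
    pass (card_index cr q.1.1, card_index cr q.2) w) (game s [::]).
Proof.
move=> /and3P[/injectiveP ci /injectiveP ri /eqP <-] [Nn h].
rewrite /t_PNG_height {}Nn.
have leE (f : {ffun 'I_n -> 'I_M}) (z : 'I_n -> R) : injective f ->
    (forall i, @cell R M (f i) (z i)) -> forall i j, (z i <= z j) = (f i <= f j)%N.
  move=> fi fz i j; case: (ltngtP (f i) (f j)) => [ij|ji|].
  - by rewrite ltW// (cell_lt M_gt0 (fz _) (fz _) ij).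
  - by rewrite leNgt (cell_lt M_gt0 (fz _) (fz _) ji).
  - by move=> /val_inj/fi ->; rewrite lexx.
rewrite -(@eval_game_png_height R n (fun i => pt i w) (fun i j => pass (i, j) w)
  (fun i => cr.1 i : nat) (fun i => cr.2 i : nat) _ _ _ _ (card_index cr)) //.
- by move=> i j /val_inj/ci.
- by move=> i j /val_inj/ri.
- by apply: leE => // i; case: (h i).
- by apply: leE => // i; case: (h i).
- by move=> i; exact: idxK.
- move=> i; have [h1 h2] := h i.
  have /andP[_ ->] := cell_unit M_gt0 (ltn_ord _) h1.
  by have /andP[-> /ltW ->] := cell_unit M_gt0 (ltn_ord _) h2.
Qed.

(** On this event the height is the value of a fixed tree. The event depends on the points only,
    hence is independent of the coins, and [prob_dtree] applies with the coin of card [i] and top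
    [e] being that of the two corresponding points. *)
Lemma prob_height_in_config n s (cr : config n) (B : set nat) : configs s cr ->
  P (in_config cr `&` (t_PNG_height N pt pass 1 1 @^-1` B))
  = (P (in_config cr) * (dtree_law t B (game s [::]))%:E)%E.
Proof.
move=> cs.
rewrite (_ : _ `&` _ = in_config cr `&` [set w | B (dtree_eval (fun q : nat * nat * nat =>
    pass (card_index cr q.1.1, card_index cr q.2) w) (game s [::]))]); last first.
  by apply/seteqP; split=> w [wc /= Bw]; split=> //=;
    [rewrite -(height_in_config cs wc)|rewrite (height_in_config cs wc)].
have [_ coins] := hPNG.
apply: (prob_dtree t01 coins (in_config_event cr) (measurable_in_config cr)
  (f := fun q : nat * nat * nat => (card_index cr q.1.1, card_index cr q.2))).
case/and3P: cs => _ /injectiveP ri /eqP <-.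
set D := mem (map (rank (fun i => cr.2 i : nat)) (enum 'I_n)).
have idx_inj : {in D &, injective (card_index cr)}.
  move=> _ _ /mapP[i _ ->] /mapP[j _ ->]; rewrite !idxK// => /val_inj ->.
  by [].
have rinj : injective (fun i => cr.2 i : nat) by move=> i j /val_inj/ri.
apply: (@read_once_game _ _ (card_index cr) (fun _ => card_index cr) D) => //.
- move=> k es /allP Des ues.
  rewrite (_ : map _ _ = map (card_index cr) es).
    by rewrite map_inj_in_uniq// => x y /Des xD /Des yD; exact: idx_inj.
  by elim: es k {Des ues} => //= e es IH k; rewrite IH.
- by apply/allP => _ /mapP[i _ ->]; apply: map_f; rewrite mem_enum.
- exact: deck_of_uniq.
Qed.

(** Only a part of the event that the points define the deck [s]: two points in a common row or
    column of the grid are excluded. *)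
Definition deck_event (s : seq nat) : set T :=
  \bigcup_(cr in [set` [seq cr <- enum {: config (size s)} | configs s cr]]) in_config cr.

Lemma measurable_deck_event s : measurable (deck_event s).
Proof.
by apply: fin_bigcup_measurable => // cr _; exact: measurable_in_config.
Qed.

Lemma in_config_inj n (cr cr' : config n) w : in_config cr w -> in_config cr' w -> cr = cr'.
Proof.
case: cr cr' => [c r] [c' r'] [_ /= h] [_ /= h'].
by congr pair; apply/ffunP => i; have [] := box_inj M_gt0 (h i) (h' i) => ? ?; exact: val_inj.
Qed.

Lemma prob_height_deck_event s (B : set nat) :
  P (deck_event s `&` (t_PNG_height N pt pass 1 1 @^-1` B))
  = (P (deck_event s) * (dtree_law t B (game s [::]))%:E)%E.
Proof.
have ur : uniq [seq cr <- enum {: config (size s)} | configs s cr].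
  by rewrite filter_uniq// enum_uniq.
have mH : measurable (t_PNG_height N pt pass 1 1 @^-1` B).
  exact: dmeasurable_t_PNG_height.
rewrite /deck_event setI_bigcupl !(measure_seq_bigcup P ur).
- rewrite ge0_sume_distrl//; apply: eq_big_seq => cr.
  by rewrite mem_filter => /andP[cs _]; exact: prob_height_in_config.
- by move=> cr cr' _ _ [w [h h']]; exact: in_config_inj h h'.
- by move=> cr; exact: measurable_in_config.
- by move=> cr cr' _ _ [w [[h _] [h' _]]]; exact: in_config_inj h h'.
- by move=> cr; apply: measurableI => //; exact: measurable_in_config.
Qed.

(** The outcome determines the configuration and therefore the deck, so the events for distinct
    decks are disjoint; they need not cover the whole space, whence an inequality. *)
Lemma sum_prob_deck_event_le (S : seq (seq nat)) (B : set nat) : uniq S ->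
  (\sum_(s <- S) P (deck_event s) * (dtree_law t B (game s [::]))%:E
   <= P (t_PNG_height N pt pass 1 1 @^-1` B))%E.
Proof.
move=> uS; have mH : measurable (t_PNG_height N pt pass 1 1 @^-1` B).
  exact: dmeasurable_t_PNG_height.
under eq_bigr do rewrite -prob_height_deck_event.
rewrite -(measure_seq_bigcup P uS).
- rewrite le_measure ?inE//.
    apply: fin_bigcup_measurable => // s _; apply: measurableI => //.
    exact: measurable_deck_event.
  by move=> w [s _ []].
- move=> s s' _ _ [w [[[cr crs h] _] [[cr' crs' h'] _]]].
  move: crs crs'; rewrite /= !mem_filter.
  move=> /andP[/and3P[_ _ /eqP sE] _] /andP[/and3P[_ _ /eqP sE'] _].
  have [[Ns _] [Ns' _]] := (h, h').
  (* Both sizes equal [N w]; rewriting with this gives the two configurations the same type. *)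
  have Nn : size s = size s' by rewrite -Ns -Ns'.
  move: cr' sE' h'; rewrite -Nn => cr' sE' h'.
  by rewrite -sE -sE' (in_config_inj h h').
- by move=> s; apply: measurableI => //; exact: measurable_deck_event.
Qed.

End png_on_grid.

(** * Occupancy of the grid by a Poisson point process *)

Section deck_of_permutation.
Local Open Scope nat_scope.
Variables (n : nat) (tau kappa : 'I_n -> 'I_n) (a b : 'I_n -> nat).
Hypothesis tau_inj : injective tau.
Hypothesis kappa_inj : injective kappa.
Hypothesis a_mono : forall k l, (a k < a l) = (k < l).
Hypothesis b_mono : forall k l, (b k < b l) = (k < l).

Let card_reindex (f : 'I_n -> 'I_n) (Q : pred 'I_n) : injective f ->
  #|[pred k | Q (f k)]| = #|[pred k | Q k]|.
Proof.
move=> fI; rewrite -!sum1_card [RHS](reindex f)//=.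
exact/onW_bij/injF_bij.
Qed.

Let a_mono_leq k l : (a k <= a l) = (k <= l).
Proof. by rewrite leqNgt a_mono -leqNgt. Qed.

(** Point [i] is the [kappa i]-th from the left; [a] lists the occupied columns and [b] the occupied
    rows in increasing order. The labelling [kappa] cancels, and the successor appears because ranks
    start at 1. *)
Lemma deck_of_perm :
  deck_of (fun i => a (kappa i)) (fun i => b (tau (kappa i)))
  = [seq (tau k).+1 | k <- enum 'I_n].
Proof.
set col := fun i => a _; set row := fun i => b _.
have [kinv kK Kk] := injF_bij kappa_inj.
have -> : deck_of col row = map (rank row) (map kinv (enum 'I_n)).
  congr map; apply: (@sorted_eq _ (relpre col leq)).
  - by move=> ? ? ?; exact: leq_trans.
  - move=> i j /= ij; apply: kappa_inj; apply: val_inj => /=.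
    by apply/eqP; rewrite eqn_leq -!a_mono_leq.
  - exact: by_column_sorted.
  - rewrite sorted_map; have : sorted ltn (map val (enum 'I_n)).
      by rewrite val_enum_ord iota_ltn_sorted.
    rewrite sorted_map; apply: sub_sorted => k l /= kl.
    by rewrite /col !Kk a_mono_leq ltnW.
  - apply: uniq_perm; first exact: by_column_uniq.
      by rewrite map_inj_uniq ?enum_uniq//; exact: can_inj Kk.
    move=> i; rewrite mem_by_column; apply/esym/mapP; exists (kappa i) => //.
    by rewrite mem_enum.
rewrite -map_comp; apply: eq_map => k /=.
rewrite /rank /row Kk.
rewrite (card_reindex (fun l => b (tau l) <= b (tau k)) kappa_inj).
rewrite (card_reindex (fun l => b l <= b (tau k)) tau_inj).
rewrite (eq_card (B := [pred l : 'I_n | l < (tau k).+1])); last first.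
  by move=> l; rewrite !inE leqNgt b_mono -leqNgt ltnS.
rewrite -sum1_card (big_ord_narrow_cond (F := fun _ => 1) (P := xpredT) (ltn_ord (tau k)))/=.
by rewrite sum1_card card_ord.
Qed.

End deck_of_permutation.

(** Stated for two sizes because it serves to prove that [N w] equals [n]. *)
Lemma injF_surj (n m : nat) (kappa : 'I_m -> 'I_n) : injective kappa ->
  (forall k, exists i, kappa i = k) -> bijective kappa.
Proof.
move=> kI /choice[g gK]; exists g => // i; exact/kI/gK.
Qed.

Lemma poisson_prob_set1 (R : realType) (r : R) k : 0 < r ->
  poisson_prob r 0%N [set k] = (r ^+ k / k`!%:R * expR (- r))%:E.
Proof.
move=> r0; rewrite /poisson_prob r0 esum_set1 /poisson_pmf ?r0//.
by rewrite lee_fin !mulr_ge0// ?expR_ge0// exprn_ge0// ltW.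
Qed.

(** The rate 0 is included since the complement of the boxes is negligible when [n] and [M] are both
    1; the law is then the Dirac mass at 0. *)
Lemma poisson_prob_set0 (R : realType) (r : R) : 0 <= r ->
  poisson_prob r 0%N [set 0%N] = (expR (- r))%:E.
Proof.
rewrite le_eqVlt => /predU1P[<-|r0].
  by rewrite /poisson_prob ltxx diracE mem_set// oppr0 expR0.
by rewrite poisson_prob_set1// expr0 fact0 divr1 mul1r.
Qed.

Lemma mem_deck_event (R : realType) (d : measure_display) (T : measurableType d)
    (P : probability T R) (N : {RV P >-> nat})
    (pt : nat -> {RV P >-> (measurableTypeR R * measurableTypeR R)%type})
    (M n : nat) (s : seq nat) (cr : config M n) w :
  size s = n -> configs s cr -> in_config N pt cr w -> deck_event N pt M s w.
Proof.
move=> sn; move: cr; rewrite -sn => cr cs crw; exists cr => //=.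
by rewrite mem_filter cs mem_enum.
Qed.

Section occupancy.
Variables (R : realType) (t theta : R) (d : measure_display) (T : measurableType d).
Variables (P : probability T R) (N : {RV P >-> nat}).
Variable pt : nat -> {RV P >-> (measurableTypeR R * measurableTypeR R)%type}.
Variable pass : nat * nat -> {RV P >-> bool}.
Hypothesis theta_gt0 : 0 < theta.
Hypothesis hPNG : t_PNG t theta N pt pass.
Variable M : nat.
Hypothesis M_gt0 : (0 < M)%N.
Variables (n : nat) (tau : 'I_n -> 'I_n).
Hypothesis tau_inj : injective tau.

Let points := t_PNG_points hPNG.

(** An increasing tuple encodes a choice of [n] columns, or of [n] rows, among [M]; there are
    ['C(M, n)] of them. *)
Definition sorted_tuples : {set n.-tuple 'I_M} :=
  [set u : n.-tuple 'I_M | sorted ltn (map val u)]%SET.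

Lemma sorted_tuples_mono u : u \in sorted_tuples ->
  forall k l : 'I_n, (tnth u k < tnth u l)%N = (k < l)%N.
Proof.
rewrite inE => su.
have h (k l : 'I_n) : (k < l)%N -> (tnth u k < tnth u l)%N.
  move=> kl; have /(_ 0%N k l) := sorted_ltn_nth ltn_trans _ su.
  rewrite !inE !size_map size_tuple !ltn_ord => /(_ isT isT kl).
  by rewrite !(nth_map (tnth u k)) ?size_tuple// -!tnth_nth.
move=> k l; case: (ltngtP k l) => [/h//|/h lk|/val_inj->]; last exact: ltnn.
by apply/negbTE; rewrite -leqNgt ltnW.
Qed.

(** The [k]-th chosen column is matched with the chosen row of index [tau k], so that the deck is
    the permutation [tau]. *)
Definition tuple_box (u v : n.-tuple 'I_M) (k : 'I_n) :
    set (measurableTypeR R * measurableTypeR R) :=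
  @box R M (tnth u k : nat, tnth v (tau k) : nat).

Definition outside u v : set (measurableTypeR R * measurableTypeR R) :=
  @unit_square R `\` \bigcup_(k in [set` enum 'I_n]) tuple_box u v k.

(** Expressed by counts alone, with no reference to labels, because the Poisson hypotheses bear on
    counts: one point in each box and none in the rest of the square. *)
Definition occupancy_event u v : set T :=
  (\bigcap_(k in [set: 'I_n]) (point_count N pt (tuple_box u v k) @^-1` [set 1%N])) `&`
  point_count N pt (outside u v) @^-1` [set 0%N].

Lemma measurable_tuple_box u v k : measurable (tuple_box u v k).
Proof. exact: measurable_box. Qed.

Lemma measurable_unit_square :
  measurable (@unit_square R : set (measurableTypeR R * measurableTypeR R)).
Proof. by apply: measurableX; exact: measurable_itv. Qed.

Lemma measurable_outside u v : measurable (outside u v).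
Proof.
apply: measurableD; first exact: measurable_unit_square.
by apply: fin_bigcup_measurable => // k _; exact: measurable_tuple_box.
Qed.

Lemma measurable_occupancy_event u v : measurable (occupancy_event u v).
Proof.
apply: measurableI.
  apply: fin_bigcap_measurable => // k _.
  exact: (dmeasurable_point_count N pt (measurable_tuple_box u v k)).
exact: (dmeasurable_point_count N pt (measurable_outside u v)).
Qed.

Lemma tuple_box_inj u v k l z : u \in sorted_tuples ->
  tuple_box u v k z -> tuple_box u v l z -> k = l.
Proof.
move=> su kz lz; have [ukl _] := box_inj M_gt0 kz lz.
by apply: val_inj; case: (ltngtP k l) => // h; have := sorted_tuples_mono su;
  [move=> /(_ k l)|move=> /(_ l k)]; rewrite h ukl ltnn.
Qed.

(** Every point lies in some box since none is outside, and every box contains exactly one point;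
    sending a point to its box is thus bijective. *)
Lemma occupancy u v w : u \in sorted_tuples -> occupancy_event u v w ->
  exists kappa : 'I_(N w) -> 'I_n,
    bijective kappa /\ forall i, tuple_box u v (kappa i) (pt i w).
Proof.
move=> su [h1 h0].
have inbox (i : 'I_(N w)) : exists k : 'I_n, tuple_box u v k (pt i w).
  apply: contrapT => nbox; move: h0; rewrite /= /point_count (bigD1 i)//=.
  rewrite mem_set//; split; first exact: (ppp_support points (ltn_ord i)).
  by move=> [k _ kz]; apply: nbox; exists k.
have [kappa kz] := choice inbox; exists kappa; split=> //.
apply: injF_surj => [i j ij|k].
  apply/eqP; apply: contraT => nij; have := h1 (kappa i) Logic.I.
  rewrite /= /point_count (bigD1 i)//= mem_set; last exact: kz.
  rewrite (bigD1 j) 1?eq_sym//= mem_set//.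
  by rewrite ij; exact: kz.
have := h1 k Logic.I; rewrite /= /point_count => /eqP.
apply: contraPP => /forallNP nk; rewrite big1// => i _.
by rewrite memNset// => ikz; apply: (nk i); exact: tuple_box_inj su (kz i) ikz.
Qed.

Lemma occupancy_deck_event u v : u \in sorted_tuples -> v \in sorted_tuples ->
  occupancy_event u v `<=`
  deck_event N pt M [seq (tau k).+1 | k <- enum 'I_n].
Proof.
move=> su sv w /(occupancy su)[kappa [kbij kz]].
have Nn : N w = n by have := bij_eq_card kbij; rewrite !card_ord.
have sn : size [seq (tau k).+1 | k <- enum 'I_n] = n by rewrite size_map size_enum_ord.
move: kappa kbij kz; rewrite Nn => kappa kbij kz.
have kinj := bij_inj kbij.
have tuple_inj u0 : u0 \in sorted_tuples -> injective (tnth u0).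
  move=> su0 k l kl; have h := sorted_tuples_mono su0.
  by case: (ltngtP k l) (h k l) (h l k) => [_|_|/val_inj//]; rewrite kl ltnn.
pose cr : config M n :=
  ([ffun i => tnth u (kappa i)], [ffun i => tnth v (tau (kappa i))]).
apply: (mem_deck_event (cr := cr) sn).
  apply/and3P; split.
  - by apply/injectiveP => i j; rewrite !ffunE => /(tuple_inj _ su)/kinj.
  - by apply/injectiveP => i j; rewrite !ffunE => /(tuple_inj _ sv)/tau_inj/kinj.
  - rewrite -(deck_of_perm tau_inj kinj (sorted_tuples_mono su) (sorted_tuples_mono sv)).
    by rewrite /config_deck /=; apply/eqP; congr deck_of; apply/funext => i; rewrite ffunE.
by split=> // i; rewrite !ffunE; exact: kz.
Qed.

(** The sets of occupied columns and rows are read off the points, and an increasing tuple is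
    determined by the set of its entries. *)
Lemma occupancy_event_inj u v u' v' w :
  u \in sorted_tuples -> v \in sorted_tuples ->
  u' \in sorted_tuples -> v' \in sorted_tuples ->
  occupancy_event u v w -> occupancy_event u' v' w -> (u, v) = (u', v').
Proof.
move=> su sv su' sv' /(occupancy su)[k [kbij kz]] /(occupancy su')[k' [kbij' kz']].
have tuple_eq x y : x \in sorted_tuples -> y \in sorted_tuples -> x =i y -> x = y.
  rewrite !inE => sx sy xy; apply: val_inj; apply: (inj_map val_inj).
  apply: (irr_sorted_eq ltn_trans ltnn sx sy) => m.
  by apply/mapP/mapP => -[i + ->]; rewrite -?xy ?xy => im; exists i; rewrite -?xy ?xy.
have boxE i : (tnth u (k i) = tnth u' (k' i)) /\ (tnth v (tau (k i)) = tnth v' (tau (k' i))).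
  by have [/val_inj ? /val_inj ?] := box_inj M_gt0 (kz i) (kz' i).
have tbij := injF_bij tau_inj.
have mem_tuple x (f : 'I_(N w) -> 'I_n) i : bijective f ->
  (i \in (x : n.-tuple 'I_M)) <-> exists j, i = tnth x (f j).
  move=> [g fK gK]; split=> [/tnthP[j ->]|[j ->]]; last exact: mem_tnth.
  by exists (g j); rewrite gK.
congr pair; apply: tuple_eq => // i; apply/idP/idP.
- by move=> /(mem_tuple _ _ _ kbij)[j ->]; rewrite (boxE j).1 mem_tnth.
- by move=> /(mem_tuple _ _ _ kbij')[j ->]; rewrite -(boxE j).1 mem_tnth.
- move=> /(mem_tuple _ _ _ (bij_comp tbij kbij))[j ->] /=.
  by rewrite (boxE j).2 mem_tnth.
- move=> /(mem_tuple _ _ _ (bij_comp tbij kbij'))[j ->] /=.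
  by rewrite -(boxE j).2 mem_tnth.
Qed.

Let prob_point_count (A : set (measurableTypeR R * measurableTypeR R)) k r :
  measurable A -> A `<=` @unit_square R ->
  ((lebesgue_measure \x lebesgue_measure) A = r%:E)%E ->
  P (point_count N pt A @^-1` [set k]) = poisson_prob (theta ^+ 2 * r) 0%N [set k].
Proof.
move=> mA AD Ar; have := ppp_poisson points mA AD.
by rewrite /= Ar -EFinM ltry => /(_ isT) /(_ [set k]).
Qed.

Lemma lebesgue_outside u v : u \in sorted_tuples ->
  (lebesgue_measure \x lebesgue_measure)%E (outside u v) = (1 - n%:R / M%:R ^+ 2)%:E.
Proof.
move=> su; set mu : {measure set (measurableTypeR R * measurableTypeR R) -> \bar R} :=
  (lebesgue_measure \x lebesgue_measure)%E.
have mU : measurable (\bigcup_(k in [set` enum 'I_n]) tuple_box u v k).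
  by apply: fin_bigcup_measurable => // k _; exact: measurable_tuple_box.
have mu1 : mu (@unit_square R) = 1%E by exact: lebesgue_unit_square.
rewrite /outside (@measureD _ _ _ mu _ _ measurable_unit_square mU); last first.
  by rewrite [X in (X < _)%E]mu1 ltry.
rewrite setIC setIidl; last first.
  by move=> z [k _]; apply: (box_unit_square M_gt0); exact: ltn_ord.
have muU : mu (\bigcup_(k in [set` enum 'I_n]) tuple_box u v k) = (n%:R / M%:R ^+ 2)%:E.
  rewrite (measure_seq_bigcup mu) ?enum_uniq//.
  - rewrite (eq_bigr (fun=> (M%:R ^- 2)%:E)); last by move=> k _; exact: lebesgue_box.
    by rewrite sumEFin big_enum /= sumr_const card_ord mulr_natl.
  - by move=> k l _ _ [z [kz lz]]; exact: tuple_box_inj su kz lz.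
  - by move=> k; exact: measurable_tuple_box.
by rewrite [X in (_ - X)%E]muU [X in (X - _)%E]mu1.
Qed.

(** Each box contributes [theta ^+ 2 / M ^+ 2] times an exponential, and the outside an exponential.
    As the areas add up to 1, the exponentials multiply to [expR (- theta ^+ 2)], whatever the
    choice of boxes. *)
Lemma prob_occupancy_event u v : u \in sorted_tuples ->
  P (occupancy_event u v) = ((theta ^+ 2 / M%:R ^+ 2) ^+ n * expR (- theta ^+ 2))%:E.
Proof.
move=> su.
(* Index 0 stands for the outside and the others for the boxes; the required count [c] is 0 or 1
   accordingly. *)
pose reg (k : 'I_n.+1) := if unlift ord0 k is Some j then tuple_box u v j else outside u v.
pose c (k : 'I_n.+1) : nat := unlift ord0 k.
have mreg k : measurable (reg k) /\ reg k `<=` @unit_square R.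
  rewrite /reg; case: unliftP => [j _|_]; split.
  - exact: measurable_tuple_box.
  - by apply: (box_unit_square M_gt0); exact: ltn_ord.
  - exact: measurable_outside.
  - by move=> z [].
have treg : trivIset [set: 'I_n.+1] reg.
  move=> k l _ _ [z []]; rewrite /reg.
  case: unliftP => [i ->|->]; case: unliftP => [j ->|->]//.
  - by move=> iz jz; rewrite (tuple_box_inj su iz jz).
  - by move=> iz [_ nz]; exfalso; apply: nz; exists i => //=; rewrite mem_enum.
  - by move=> [_ nz] jz; exfalso; apply: nz; exists j => //=; rewrite mem_enum.
have -> : occupancy_event u v =
    \bigcap_(k in [set` enum 'I_n.+1]) (point_count N pt (reg k) @^-1` [set c k]).
  apply/seteqP; split=> w.
    move=> [h1 h0] k _; rewrite /reg /c; case: unliftP => [j _|_] //.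
    exact: h1.
  move=> h; split=> [j _|].
    by have := h (lift ord0 j); rewrite /reg /c liftK /= mem_enum; apply.
  by have := h ord0; rewrite /reg /c unlift_none /= mem_enum; apply.
rewrite (mutually_independent_seq (ppp_independent points mreg treg)) ?enum_uniq//; last first.
  by move=> k _; exists [set c k] => //; rewrite setTI.
rewrite big_enum big_ord_recl /= {1}/reg {1}/c unlift_none.
have rest_ge0 : 0 <= 1 - n%:R / M%:R ^+ 2 :> R.
  by rewrite -lee_fin -(lebesgue_outside v su) measure_ge0.
have M2 : 0 < theta ^+ 2 * M%:R ^- 2.
  by rewrite mulr_gt0 ?exprn_gt0// invr_gt0 exprn_gt0// ltr0n.
rewrite (prob_point_count _ (measurable_outside u v) _ (lebesgue_outside v su));
  last by move=> z [].
rewrite poisson_prob_set0; last by rewrite mulr_ge0// exprn_ge0// ltW.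
rewrite (eq_bigr (fun=>
    (theta ^+ 2 / M%:R ^+ 2 * expR (- (theta ^+ 2 / M%:R ^+ 2)))%:E)); last first.
  move=> j _; rewrite /reg /c liftK.
  rewrite (prob_point_count _ (measurable_tuple_box u v j) _ (lebesgue_box _ M_gt0 _)).
    by rewrite poisson_prob_set1// expr1 divr1.
  by apply: (box_unit_square M_gt0); exact: ltn_ord.
rewrite prodEFin -EFinM prodr_const card_ord; congr EFin.
rewrite exprMn mulrCA; congr (_ * _).
rewrite -expRM_natl -expRD; congr expR.
by rewrite mulrBr mulr1 mulrA mulrAC -[_ *+ n]mulr_natl; ring.
Qed.

Lemma prob_deck_event_ge :
  (('C(M, n)%:R ^+ 2 * (theta ^+ 2 / M%:R ^+ 2) ^+ n * expR (- theta ^+ 2))%:E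
   <= P (deck_event N pt M [seq (tau k).+1 | k <- enum 'I_n]))%E.
Proof.
pose r := enum (finset.setX sorted_tuples sorted_tuples).
have rP uv : uv \in r -> uv.1 \in sorted_tuples /\ uv.2 \in sorted_tuples.
  by rewrite mem_enum inE => /andP[].
have mE uv : measurable (occupancy_event uv.1 uv.2) by exact: measurable_occupancy_event.
have ur : uniq r by exact: enum_uniq.
apply: (@le_trans _ _ (P (\bigcup_(uv in [set` r]) occupancy_event uv.1 uv.2))).
  rewrite (measure_seq_bigcup P ur)//; last first.
    move=> uv uv' /rP[su sv] /rP[su' sv'] [w [h h']].
    have := occupancy_event_inj su sv su' sv' h h'.
    by rewrite -!surjective_pairing.
  rewrite (eq_big_seq (fun=> ((theta ^+ 2 / M%:R ^+ 2) ^+ n * expR (- theta ^+ 2))%:E)).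
    rewrite sumEFin big_const_seq count_predT -cardE cardsX card_ltn_sorted_tuples.
    by rewrite iter_addr_0 -(mulr_natl _ ('C(M, n) * 'C(M, n))) natrM -expr2 mulrA.
  by move=> uv /rP[su _]; exact: prob_occupancy_event.
rewrite le_measure ?inE//.
- by apply: fin_bigcup_measurable => // uv _; exact: measurable_occupancy_event.
- exact: measurable_deck_event.
- by move=> w [uv /rP[su sv] h]; exact: occupancy_deck_event h.
Qed.

End occupancy.

(** * Comparison of the two laws *)

Lemma dtree_law_ge0 (R : realType) (p : R) A V (B : set V) (u : dtree A V) :
  0 <= p <= 1 -> 0 <= dtree_law p B u.
Proof.
move=> /andP[p0 p1]; elim: u => //= _ u1 h1 u0 h0.
by rewrite addr_ge0// mulr_ge0// subr_ge0.
Qed.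

Lemma cvg_ffact (R : realType) n :
  (fun M => (M.+1 ^_ n)%:R / M.+1%:R ^+ n : R) @ \oo --> (1 : R).
Proof.
elim: n => [|n IH].
  under eq_fun do rewrite ffactn0 expr0 divr1.
  exact: cvg_cst.
rewrite -[X in _ --> X]mulr1.
have -> : (fun M => (M.+1 ^_ n.+1)%:R / M.+1%:R ^+ n.+1 : R) =
    (fun M => ((M.+1 ^_ n)%:R / M.+1%:R ^+ n) * (1 - n%:R * harmonic M)).
  apply/funext => M; have M0 : M.+1%:R != 0 :> R by rewrite pnatr_eq0.
  (* When [n] exceeds [M.+1] the real factor is negative, but the falling factorial in front of it
     vanishes. *)
  have -> : (M.+1 ^_ n.+1)%:R = (M.+1 ^_ n)%:R * (M.+1%:R - n%:R) :> R.
    rewrite ffactnSr natrM; have [nM|Mn] := leqP n M.+1; first by rewrite natrB.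
    by rewrite ffact_small// !mul0r.
  rewrite /harmonic /= exprSr; move: (M.+1%:R) (_ ^_ _)%:R M0 => x y x0.
  by move: (x ^+ n) (expf_neq0 n x0) => z z0; field; rewrite x0.
apply: cvgM => //; rewrite -[X in _ --> X]subr0; apply: cvgB; first exact: cvg_cst.
by rewrite -[X in _ --> X](mulr0 n%:R); apply: cvgMr; exact: cvg_harmonic.
Qed.

Lemma cvg_bin_sqr (R : realType) (x : R) n :
  (fun M => 'C(M.+1, n)%:R ^+ 2 * (x / M.+1%:R ^+ 2) ^+ n) @ \oo -->
  x ^+ n / n`!%:R ^+ 2.
Proof.
have n0 : n`!%:R != 0 :> R by rewrite pnatr_eq0 -lt0n fact_gt0.
have -> : (fun M => 'C(M.+1, n)%:R ^+ 2 * (x / M.+1%:R ^+ 2) ^+ n) =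
    (fun M => ((M.+1 ^_ n)%:R / M.+1%:R ^+ n) * ((M.+1 ^_ n)%:R / M.+1%:R ^+ n)
              * (x ^+ n / n`!%:R ^+ 2)).
  apply/funext => M; have M0 : M.+1%:R != 0 :> R by rewrite pnatr_eq0.
  rewrite -bin_ffact natrM expr_div_n -exprM mulnC exprM.
  move: (_ ^+ n) (expf_neq0 n M0) => z z0.
  by move: (n`!%:R) n0 => y y0; field; rewrite y0.
rewrite -[X in _ --> X]mul1r; apply: cvgMl.
by rewrite -[X in _ --> X]mulr1; apply: cvgM; exact: cvg_ffact.
Qed.

Lemma cvg_sum_seq (R : realType) (I : Type) (S : seq I) (f : I -> nat -> R) (l : I -> R) :
  (forall i, f i @ \oo --> l i) ->
  (fun M => \sum_(i <- S) f i M) @ \oo --> \sum_(i <- S) l i.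
Proof.
move=> fl; elim: S => [|i S IH].
  by under eq_fun do rewrite big_nil; rewrite big_nil; exact: cvg_cst.
by under eq_fun do rewrite big_cons; rewrite big_cons; exact: cvgD.
Qed.

(** Puts a deck in the form used by the occupancy bound, a permutation of ['I_n] shifted by one. *)
Lemma perm_iotaE n (s : seq nat) : perm_eq s (iota 1 n) ->
  exists2 tau : 'I_n -> 'I_n, injective tau & s = [seq (tau k).+1 | k <- enum 'I_n].
Proof.
move=> sn; have us : uniq s by rewrite (perm_uniq sn) iota_uniq.
have ss : size s = n by rewrite (perm_size sn) size_iota.
have tauP (k : 'I_n) : exists j : 'I_n, nth 0%N s k = j.+1.
  have : nth 0%N s k \in iota 1 n by rewrite -(perm_mem sn) mem_nth// ss.
  rewrite mem_iota; case: (nth 0%N s k) => // j; rewrite /= add1n ltnS => jn.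
  by exists (Ordinal jn).
have [tau tauE] := choice tauP; exists tau.
  move=> k l kl; apply: val_inj; apply/eqP.
  by rewrite /= -(nth_uniq 0%N _ _ us) ?ss ?ltn_ord// !tauE kl.
apply: (@eq_from_nth _ 0%N); first by rewrite size_map size_enum_ord.
move=> i; rewrite ss => iN; rewrite (nth_map (Ordinal iN)) ?size_enum_ord//.
by rewrite -tauE nth_enum_ord.
Qed.

(** * Lower bound on the law of the height *)

Section png_lower_bound.
Variables (R : realType) (t theta : R) (d : measure_display) (T : measurableType d).
Variables (P : probability T R) (N : {RV P >-> nat}).
Variable pt : nat -> {RV P >-> (measurableTypeR R * measurableTypeR R)%type}.
Variable pass : nat * nat -> {RV P >-> bool}.
Hypothesis t01 : 0 <= t <= 1.
Hypothesis theta_gt0 : 0 < theta.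
Hypothesis hPNG : t_PNG t theta N pt pass.

(** One factorial comes from the Poisson law of the size and the other from the uniform choice of
    the order. It is also the limit of the bound [prob_deck_event_ge] as [M] grows. *)
Definition deck_weight (s : seq nat) : R :=
  (theta ^+ 2) ^+ size s / (size s)`!%:R ^+ 2 * expR (- theta ^+ 2).

(** The sum is finite, so the grid bounds pass to the limit term by term, while the right-hand side
    does not depend on [M]. *)
Lemma sum_deck_weight_le (S : seq (seq nat)) (B : set nat) : uniq S ->
  all (fun s => perm_eq s (iota 1 (size s))) S ->
  ((\sum_(s <- S) deck_weight s * dtree_law t B (game s [::]))%:E
   <= P (t_PNG_height N pt pass 1 1 @^-1` B))%E.
Proof.
move=> uS /allP hS.
have mH : measurable (t_PNG_height N pt pass 1 1 @^-1` B).
  exact: dmeasurable_t_PNG_height.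
rewrite -(fineK (fin_num_measure P _ mH)) lee_fin.
pose f s M : R := 'C(M.+1, size s)%:R ^+ 2 * (theta ^+ 2 / M.+1%:R ^+ 2) ^+ size s
  * expR (- theta ^+ 2) * dtree_law t B (game s [::]).
have fl s : f s @ \oo --> deck_weight s * dtree_law t B (game s [::]).
  by apply: cvgMl; apply: cvgMl; exact: cvg_bin_sqr.
apply: (cvgr_to_le (cvg_sum_seq (S := S) fl)); apply: nearW => M.
rewrite -lee_fin (fineK (fin_num_measure P _ mH)).
apply: le_trans (sum_prob_deck_event_le t01 hPNG (M := M.+1) _ B uS) => //.
rewrite -sumEFin; rewrite !big_seq; apply: lee_sum => s /hS sp.
have [tau taui sE] := perm_iotaE sp.
rewrite /f EFinM lee_pmul//.
- by rewrite lee_fin mulr_ge0 ?expR_ge0// mulr_ge0 ?exprn_ge0// divr_ge0// exprn_ge0// ltW.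
- by rewrite lee_fin dtree_law_ge0.
- have := prob_deck_event_ge theta_gt0 hPNG (M := M.+1) (ltn0Sn _) taui.
  by rewrite -sE.
Qed.

End png_lower_bound.

(** * The law of the number of piles *)

Section patience_law.
Variables (R : realType) (t theta : R) (d : measure_display) (T : measurableType d).
Variables (P : probability T R) (N : {RV P >-> nat}) (deck : T -> seq nat).
Variable miss : nat * nat -> {RV P >-> bool}.
Hypothesis t01 : 0 <= t <= 1.
Hypothesis theta_gt0 : 0 < theta.
Hypothesis hdeck : shuffled_deck t (theta ^+ 2) N deck miss.

Lemma deck_uniq w : uniq (deck w).
Proof. by rewrite (perm_uniq (deck_cards hdeck w)) iota_uniq. Qed.

Lemma prob_deck s : perm_eq s (iota 1 (size s)) ->
  P (deck @^-1` [set s]) = (deck_weight theta s)%:E.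
Proof.
move=> sp; rewrite (deck_uniform hdeck sp).
have := deck_size_poisson hdeck [set size s]; rewrite /distribution /= /pushforward => ->.
rewrite poisson_prob_set1 ?exprn_gt0// -EFinM; congr EFin.
rewrite /deck_weight expr2 invfM; ring.
Qed.

Lemma prob_number_of_piles_deck s (B : set nat) : perm_eq s (iota 1 (size s)) ->
  P (deck @^-1` [set s] `&` (number_of_piles deck miss @^-1` B))
  = (deck_weight theta s * dtree_law t B (game s [::]))%:E.
Proof.
move=> sp; have us : uniq s by rewrite (perm_uniq sp) iota_uniq.
rewrite EFinM -prob_deck//.
rewrite -(@prob_dtree _ _ _ _ _ _ _ _ t01 (deck_errors hdeck) _ _ _ _ _ (fun q => (q.1.1, q.1.2))).
- congr (P _); apply/seteqP; split=> w [/= dw]; rewrite /number_of_piles dw;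
  by rewrite /patience_piles (@eval_game_patience (fun i k => miss (i, k) w) s [::] us).
- by exists [set s] => //; rewrite setTI.
- exact: (deck_measurable hdeck).
- apply: (@read_once_game _ _ id (fun k _ => k) predT) => //.
  + move=> k es _ _; rewrite (_ : map _ _ = iota k (size es)) ?iota_uniq//.
    by elim: es k => //= e es IH k; rewrite IH.
  + exact/allP.
Qed.

(** There are countably many decks; by continuity from below the probability is the limit of its
    restrictions to finitely many decks, each of which is one of the sums bounded by [x]. *)
Lemma prob_number_of_piles_le (B : set nat) (x : \bar R) :
  (forall S : seq (seq nat), uniq S ->
    all (fun s => perm_eq s (iota 1 (size s))) S ->
    ((\sum_(s <- S) deck_weight theta s * dtree_law t B (game s [::]))%:E <= x)%E) ->
  (P (number_of_piles deck miss @^-1` B) <= x)%E.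
Proof.
move=> hx; set X := number_of_piles deck miss.
have mX : measurable (X @^-1` B).
  by apply: dmeasurable_number_of_piles;
    [exact: (deck_measurable hdeck)|exact: deck_uniq].
(* The valid decks whose code as a natural number is below [m]. *)
pose S m := [seq s <- pmap (@pickle_inv (seq nat)) (iota 0 m) | perm_eq s (iota 1 (size s))].
pose F m := \bigcup_(s in [set` S m]) (deck @^-1` [set s] `&` X @^-1` B).
have mdX s : measurable (deck @^-1` [set s] `&` X @^-1` B).
  by apply: measurableI => //; exact: (deck_measurable hdeck).
have mF m : measurable (F m) by exact: fin_bigcup_measurable.
have FE w m : F m w <-> X w \in B /\ (choice.pickle (deck w) < m)%N.
  split=> [[s sS [/= ds Bw]]|[/set_mem Bw pm]].
    move: sS; rewrite -ds /= mem_filter mem_pmap => /andP[_ /mapP[k + kE]].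
    rewrite mem_iota /= => km; split; first exact/mem_set.
    by have := @pickle_invK (seq nat) k; rewrite -kE /= => ->.
  exists (deck w) => //=; rewrite mem_filter; apply/andP; split.
    have := deck_cards hdeck w => p; move: (perm_size p); rewrite size_iota => ->.
    exact: p.
  by rewrite mem_pmap; apply/mapP; exists (choice.pickle (deck w));
    rewrite ?pickleK_inv ?mem_iota.
have UF : \bigcup_m F m = X @^-1` B.
  apply/seteqP; split=> w; first by move=> [m _ /FE[/set_mem]].
  by move=> Bw; exists (choice.pickle (deck w)).+1 => //; apply/FE; split=> //; exact/mem_set.
have ndF : nondecreasing_seq F.
  move=> m m' mm'; apply/subsetPset => w /FE[Bw pm]; apply/FE; split=> //.
  exact: leq_trans pm mm'.
rewrite -UF; have := nondecreasing_cvg_mu (mu := P) mF _ ndF.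
rewrite UF => /(_ mX) cF; apply: (cvge_to_le cF); apply: nearW => m /=.
have uS : uniq (S m).
  by rewrite filter_uniq// (pmap_uniq (@pickle_invK _)) ?iota_uniq.
rewrite /F (measure_seq_bigcup P uS)//; last first.
  by move=> s s' _ _ [w [[/= <- _] [/= <- _]]].
rewrite (eq_big_seq (fun s => (deck_weight theta s * dtree_law t B (game s [::]))%:E)).
  by rewrite sumEFin hx//; exact: filter_all.
by move=> s; rewrite mem_filter => /andP[sp _]; exact: prob_number_of_piles_deck.
Qed.

End patience_law.

Theorem propositionA4 (R : realType) (t theta : R)
    (ht : 0 <= t < 1) (htheta : 0 < theta)
    (d1 : measure_display) (T1 : measurableType d1) (P1 : probability T1 R)
    (N1 : {RV P1 >-> nat}) (deck : T1 -> seq nat)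
    (miss : nat * nat -> {RV P1 >-> bool})
    (hdeck : shuffled_deck t (theta ^+ 2) N1 deck miss)
    (d2 : measure_display) (T2 : measurableType d2) (P2 : probability T2 R)
    (N2 : {RV P2 >-> nat})
    (pt : nat -> {RV P2 >-> (measurableTypeR R * measurableTypeR R)%type})
    (pass : nat * nat -> {RV P2 >-> bool})
    (hPNG : t_PNG t theta N2 pt pass) :
  same_law P1 P2 (number_of_piles deck miss) (t_PNG_height N2 pt pass 1 1).
Proof.
have t01 : 0 <= t <= 1 by case/andP: ht => -> /ltW ->.
have mX : dmeasurable (number_of_piles deck miss).
  by apply: dmeasurable_number_of_piles;
    [exact: (deck_measurable hdeck)|exact: (deck_uniq hdeck)].
have mH := dmeasurable_t_PNG_height N2 pt pass 1 1.
split; [exact: measurable_fun_nat|exact: measurable_fun_nat|].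
have le12 B : (P1 (number_of_piles deck miss @^-1` B)
    <= P2 (t_PNG_height N2 pt pass 1 1 @^-1` B))%E.
  apply: (prob_number_of_piles_le t01 htheta hdeck) => S uS aS.
  exact: sum_deck_weight_le.
move=> B _; apply/eqP; rewrite eq_le le12 /=.
(* Both laws have mass 1, so domination on the complement of [B] gives the reverse inequality on
   [B]. *)
have : (P1 (~` (number_of_piles deck miss @^-1` B))
    <= P2 (~` (t_PNG_height N2 pt pass 1 1 @^-1` B)))%E := le12 (~` B).
rewrite (probability_setC P1 (mX B)) (probability_setC P2 (mH B)).
rewrite -(fineK (fin_num_measure P1 _ (mX B))) -(fineK (fin_num_measure P2 _ (mH B))).
by rewrite -!EFinB !lee_fin lerD2l lerN2.
Qed.
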